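(* Let $f:\mathbb{T}^2\to\mathbb{T}^2$ be a continuous map of the $2$-torus, and let $M_2\in\mathcal{M}_{2\times 2}(\mathbb{Z})$ be the matrix of the induced homomorphism $f_{*1}:H_1(\mathbb{T}^2,\mathbb{Z})\to H_1(\mathbb{T}^2,\mathbb{Z})$. Let $t$ and $d$ denote the trace and the determinant of $M_2$, respectively. If $-t+d+1\neq 0$ and $$(t,d)\notin\{(0,0),\,(-1,0),\,(-2,1),\,(0,1),\,(-1,1),\,(1,1)\},$$ then $$\operatorname{card}\big(\mathrm{MPer}(f)\big)=\infty .$$
   Context: For an integer $k\ge 1$, a map $h:\mathbb{T}^2\to\mathbb{T}^2$ has a periodic point of order $k$ if there is $x\in\mathbb{T}^2$ with $h^k(x)=x$ and $h^i(x)\ne x$ for $1\le i\le k-1$. Put $\mathrm{Per}(h)=\{k\ge 1 : h \text{ has a periodic point of order } k\}$ and $\mathrm{MPer}(f)=\bigcap_{h\simeq f}\mathrm{Per}(h)$, the intersection over all continuous maps $h:\mathbb{T}^2\to\mathbb{T}^2$ homotopic to $f$. *)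

(* Defs.v *)
From HB Require Import structures.
(* Imported first so that [fintype.lift] is not shadowed by [freeg.lift]. *)
From mathcomp Require Import freeg.
From mathcomp Require Import all_boot all_order all_algebra.
From mathcomp Require Import ring_quotient.
From mathcomp Require Import mathcomp_extra boolp classical_sets functions.
From mathcomp Require Import cardinality reals topology normedtype.

Set Implicit Arguments.
Unset Strict Implicit.
Unset Printing Implicit Defensive.

Import Order.TTheory GRing.Theory Num.Theory.
Import numFieldNormedType.Exports.

Local Open Scope classical_set_scope.
Local Open Scope ring_scope.

Section Simplex.
Context {R : realType}.

Definition std_simplex (n : nat) : set 'rV[R]_n.+1 :=
  [set x | (forall i, 0 <= x 0 i) /\ \sum_i x 0 i = 1].
Arguments std_simplex : clear implicits.

Definition face_row n (i : 'I_n.+2) (x : 'rV[R]_n.+1) : 'rV[R]_n.+2 :=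
  \row_j (if unlift i j is Some k then x 0 k else 0).

Lemma face_row_lift n (i : 'I_n.+2) (x : 'rV[R]_n.+1) k :
  face_row i x 0 (lift i k) = x 0 k.
Proof. by rewrite mxE liftK. Qed.

Lemma face_row_id n (i : 'I_n.+2) (x : 'rV[R]_n.+1) : face_row i x 0 i = 0.
Proof. by rewrite mxE unlift_none. Qed.

Lemma face_row_simplex n (i : 'I_n.+2) (x : 'rV[R]_n.+1) :
  std_simplex n x -> std_simplex n.+1 (face_row i x).
Proof.
move=> [x0 x1]; split=> [j|]; first by rewrite mxE; case: unliftP => [k|] _.
rewrite (bigD1 i) //= face_row_id add0r -x1.
rewrite (reindex_onto (lift i) (fun j => odflt ord0 (unlift i j))) /=; last first.
  by move=> j; case: unliftP => [k ->|->]; rewrite ?eqxx.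
apply: eq_big => [k|k _]; last by rewrite face_row_lift.
by rewrite liftK /= eqxx andbT eq_sym neq_lift.
Qed.

Definition face n (i : 'I_n.+2) (x : std_simplex n) : std_simplex n.+1 :=
  exist _ (face_row i (set_val x))
    (mem_set (face_row_simplex i (set_mem (valP x)))).

Lemma face_row_continuous n (i : 'I_n.+2) : continuous (@face_row n i).
Proof.
move=> x A [P nP sPA].
pose Q (a : 'I_1) (k : 'I_n.+1) := P a (lift i k).
exists Q => [a k|y Qy].
  by have := nP a (lift i k); rewrite ord1 face_row_lift.
apply: sPA => a j; rewrite (ord1 a).
case: (unliftP i j) => [k ->|->].
  by rewrite face_row_lift; exact: Qy.
rewrite face_row_id.
by have := nbhs_singleton (nP 0 i); rewrite face_row_id.
Qed.

Lemma face_continuous n (i : 'I_n.+2) : continuous (@face n i).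
Proof.
apply/continuousP => _ [A oA <-].
have /continuousP cf : continuous (face_row i \o set_val : std_simplex n -> _).
  by move=> x; apply: continuous_comp; [exact: initial_continuous|exact: face_row_continuous].
exact: (cf _ oA).
Qed.

HB.instance Definition _ n (i : 'I_n.+2) :=
  isContinuous.Build _ _ (@face n i) (@face_continuous n i).

End Simplex.
Arguments std_simplex : clear implicits.

Section Homology.
Context {R : realType}.

Definition simplex (n : nat) (X : topologicalType) : Type :=
  continuousType (std_simplex R n) X.

HB.instance Definition _ n X := Choice.on (simplex n X).

Definition chain (n : nat) (X : topologicalType) : Type :=
  {freeg (simplex n X) / int}.

HB.instance Definition _ n X := GRing.Lmodule.on (chain n X).

Definition face_of n (X : topologicalType) (i : 'I_n.+2) (s : simplex n.+1 X) :
  simplex n X := s \o face i.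

Definition boundary n (X : topologicalType) : chain n.+1 X -> chain n X :=
  fglift (fun s : simplex n.+1 X =>
    \sum_(i < n.+2) << (-1) ^+ i *g face_of i s >> : chain n X).

Definition push_simplex n (X Y : topologicalType) (f : continuousType X Y)
  (s : simplex n X) : simplex n Y := f \o s.

Definition push_chain n (X Y : topologicalType) (f : continuousType X Y) :
    chain n X -> chain n Y :=
  fglift (fun s : simplex n X => << push_simplex f s >> : chain n Y).

HB.instance Definition _ n X := GRing.isZmodMorphism.Build _ _
  (@boundary n X) (lift_is_additive _).
HB.instance Definition _ n X Y f := GRing.isZmodMorphism.Build _ _
  (@push_chain n X Y f) (lift_is_additive _).

Lemma chainZ n X (k l : int) (s : simplex n X) :
  k *: (<< l *g s >> : chain n X) = << k * l *g s >>.
Proof. by apply/eqP/freeg_eqP => x; rewrite coeffZ !coeffU mulrA. Qed.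

Lemma push_chainU n (X Y : topologicalType) (f : continuousType X Y) k
    (s : simplex n X) :
  push_chain f << k *g s >> = << k *g push_simplex f s >>.
Proof. by rewrite [LHS]liftU [LHS]chainZ mulr1. Qed.

Lemma boundaryU n (X : topologicalType) k (s : simplex n.+1 X) :
  boundary << k *g s >> =
    \sum_(i < n.+2) << k * (-1) ^+ i *g face_of i s >> :> chain n X.
Proof.
by rewrite [LHS]liftU scaler_sumr; apply: eq_bigr => i _; rewrite [LHS]chainZ.
Qed.

Lemma boundary_push n (X Y : topologicalType) (f : continuousType X Y)
    (c : chain n.+1 X) :
  boundary (push_chain f c) = push_chain f (boundary c).
Proof.
rewrite -(freeg_sumE c) !raddf_sum; apply: eq_bigr => s _ /=.
rewrite push_chainU !boundaryU raddf_sum; apply: eq_bigr => i _ /=.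
rewrite push_chainU; congr << _ *g _ >>.
exact/continuousEP.
Qed.

Definition cycles n (X : topologicalType) : {pred chain n X} :=
  if n is m.+1 return {pred chain n X} then fun c => boundary c == 0
  else xpredT.

Fact cycles_zmod_closed n X : zmod_closed (@cycles n X).
Proof.
case: n => [|n]; split=> //; first by rewrite unfold_in /= raddf0.
by move=> a b; rewrite !unfold_in /= raddfB /= => /eqP -> /eqP ->; rewrite subrr.
Qed.
HB.instance Definition _ n X :=
  GRing.isZmodClosed.Build _ (@cycles n X) (@cycles_zmod_closed n X).

Record cycle n (X : topologicalType) :=
  Cycle { chain_of :> chain n X ; _ : cycles chain_of }.
HB.instance Definition _ n X := [isSub for @chain_of n X].
HB.instance Definition _ n X := [Choice of cycle n X by <:].
HB.instance Definition _ n X := [SubChoice_isSubZmodule of cycle n X by <:].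

Definition boundaries n (X : topologicalType) : {pred cycle n X} :=
  fun z => `[< exists c : chain n.+1 X, boundary c = chain_of z >].

Fact boundaries_zmod_closed n X : zmod_closed (@boundaries n X).
Proof.
split; first by apply/asboolP; exists 0; rewrite raddf0.
move=> a b /asboolP[c ca] /asboolP[d db]; apply/asboolP; exists (c - d).
by rewrite raddfB /= ca db.
Qed.
HB.instance Definition _ n X :=
  GRing.isZmodClosed.Build _ (@boundaries n X) (@boundaries_zmod_closed n X).

Local Notation quotient_by_boundaries n X :=
  (Quotient.quot (@boundaries n X)).

Definition homology n (X : topologicalType) : Type :=
  quotient_by_boundaries n X.

HB.instance Definition _ n X := GRing.Zmodule.on (homology n X).

Definition homology_class n (X : topologicalType) (z : cycle n X) :
  homology n X := (\pi_(quotient_by_boundaries n X) z)%qT.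

Fact push_cycle_subproof n (X Y : topologicalType) (f : continuousType X Y)
  (z : cycle n X) : cycles (push_chain f (chain_of z)).
Proof.
case: n z => [//|n] [c /= /eqP zc] /=.
by rewrite boundary_push zc raddf0.
Qed.

Definition push_cycle n (X Y : topologicalType) (f : continuousType X Y)
  (z : cycle n X) : cycle n Y := Cycle (push_cycle_subproof f z).

Definition homology_map n (X Y : topologicalType) (f : continuousType X Y)
  (a : homology n X) : homology n Y :=
  homology_class (push_cycle f (repr (a : quotient_by_boundaries n X))).

Lemma homology_classE n X (z w : cycle n X) :
  homology_class z = homology_class w <-> boundaries (z - w).
Proof.
rewrite /homology_class; split.
  by move=> /eqP; rewrite -Quotient.idealrBE.
by move=> zw; apply/eqP; rewrite -Quotient.idealrBE.
Qed.

Lemma homology_map_class n (X Y : topologicalType) (f : continuousType X Y)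
  (z : cycle n X) :
  homology_map f (homology_class z) = homology_class (push_cycle f z).
Proof.
apply/homology_classE/asboolP.
set w := repr _.
have /homology_classE/asboolP[c cE] : homology_class w = homology_class z.
  exact: reprK.
exists (push_chain f c); rewrite boundary_push cE.
by rewrite [LHS]raddfB.
Qed.

Fact homology_map_zmod_morphism n (X Y : topologicalType)
  (f : continuousType X Y) : zmod_morphism (@homology_map n X Y f).
Proof.
have cB Z : zmod_morphism (@homology_class n Z).
  by move=> x y; rewrite /homology_class; exact: raddfB.
move=> a b; rewrite -[a](reprK (qT := quotient_by_boundaries n X)).
rewrite -[b](reprK (qT := quotient_by_boundaries n X)).
rewrite -!/(homology_class _) -cB !homology_map_class -cB.
by congr homology_class; apply: val_inj; rewrite /= raddfB.
Qed.
HB.instance Definition _ n X Y f := GRing.isZmodMorphism.Build _ _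
  (@homology_map n X Y f) (@homology_map_zmod_morphism n X Y f).

End Homology.
Arguments simplex : clear implicits.
Arguments chain : clear implicits.
Arguments homology : clear implicits.

Definition is_Zbasis (A : zmodType) (n : nat) (e : 'I_n -> A) : Prop :=
  forall a : A, exists! c : {ffun 'I_n -> int}, a = \sum_i e i *~ c i.

(* Column convention: the j-th column of M lists the coordinates of g (e j). *)
Definition is_matrix_of (A : zmodType) (n : nat) (e : 'I_n -> A) (g : A -> A)
    (M : 'M[int]_n) : Prop :=
  forall j, g (e j) = \sum_i e i *~ M i j.

Section Torus.
Context (R : realType).

Definition integer_lattice : {pred 'rV[R]_2} :=
  fun x => [forall j, x 0 j \in Num.int].

Fact integer_lattice_zmod_closed : zmod_closed integer_lattice.
Proof.
split=> [|x y /forallP xP /forallP yP]; apply/forallP => j.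
  by rewrite mxE rpred0.
by rewrite !mxE rpredB.
Qed.
HB.instance Definition _ :=
  GRing.isZmodClosed.Build _ integer_lattice integer_lattice_zmod_closed.

(* R^2 / Z^2 with the quotient topology. *)
Definition torus : Type := quotient_topology (Quotient.quot integer_lattice).

HB.instance Definition _ := Topological.on torus.
HB.instance Definition _ :=
  Quotient.copy torus (quotient_topology (Quotient.quot integer_lattice)).

Definition homotopic (X Y : topologicalType) (f g : X -> Y) : Prop :=
  exists H : X * R -> Y,
    [/\ {within [set: X] `*` `[0, 1], continuous H},
        forall x, H (x, 0) = f x & forall x, H (x, 1) = g x].

End Torus.

Definition periods (T : Type) (h : T -> T) : set nat :=
  [set k | (1 <= k)%N /\ exists x, iter k h x = x /\
             forall i, (1 <= i <= k.-1)%N -> iter i h x <> x].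

Definition minimal_periods (R : realType) (X : topologicalType)
    (f : continuousType X X) : set nat :=
  \bigcap_(h in [set h : continuousType X X | homotopic R f h]) periods h.

(* Main.v *)
(* Choose k a large prime. A map h homotopic to f lifts to H : R^2 -> R^2 with
   H (x + w) = H x + w A for integral w, where A is an integer matrix acting on
   row vectors, depending only on the homotopy class, and conjugate to the
   transpose of M2. The hypotheses on (t, d) say that 1 is not an eigenvalue of A
   and that some eigenvalue has modulus > 1, so |det (A^k - 1)| > |det (A - 1)|
   for every large odd k. Then B = 1 + A + ... + A^(k-1) has |det B| > 1, hence
   some v in Z^2 is not in the image of B. As H^k x - x A^k is periodic, hence
   bounded, a Brouwer-type argument solves H^k x = x + v. The class of x is fixed
   by h^k; were its period smaller than the prime k, it would be fixed by h, so
   H x = x + u with u integral and v = u B, a contradiction.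

   The matrix of f on H_1 is compared with A without computing H_1: the
   displacement of a lift of a singular 1-simplex extends to chains, vanishes on
   boundaries and is integral on cycles, which gives a surjective morphism
   H_1 -> Z^2 turning f_* into A. A surjection from Z^2 to Z^2 is bijective. *)
From HB Require Import structures.
(* Imported first so that [fintype.lift] is not shadowed by [freeg.lift]. *)
From mathcomp Require Import freeg.
From mathcomp Require Import all_boot all_order all_algebra.
From mathcomp Require Import algC ring lra zify.
From mathcomp Require Import ring_quotient.
From mathcomp Require Import mathcomp_extra boolp classical_sets functions.
From mathcomp Require Import cardinality reals topology normedtype.
Require Import Defs.

Import Order.TTheory GRing.Theory Num.Theory.
Import numFieldNormedType.Exports.

(** * Growth of det (A^k - 1) *)

Section Growth.
Local Open Scope ring_scope.

Lemma det2E (S : comPzRingType) (A : 'M[S]_2) :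
  \det A = A 0 0 * A 1 1 - A 0 1 * A 1 0.
Proof.
rewrite (expand_det_row _ 0) !big_ord_recl big_ord0 addr0 /cofactor !det_mx11.
rewrite !mxE /= !expr0 !expr1 mul1r mulN1r mulrN.
by congr (_ * A _ _ - A _ _ * A _ _); apply: val_inj.
Qed.

Lemma tr2E (S : pzRingType) (A : 'M[S]_2) : \tr A = A 0 0 + A 1 1.
Proof.
by rewrite /mxtrace !big_ord_recl big_ord0 addr0; congr (_ + A _ _); apply: val_inj.
Qed.

Lemma mx2_eq (S : Type) (A B : 'M[S]_2) : A 0 0 = B 0 0 -> A 0 1 = B 0 1 ->
  A 1 0 = B 1 0 -> A 1 1 = B 1 1 -> A = B.
Proof.
move=> h00 h01 h10 h11; apply/matrixP => i j.
have E (k : 'I_2) : k = 0 \/ k = 1.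
  by case: k => [[|[|m]] lt]; [left|right|]; first [exact: val_inj|done].
by case: (E i) => ->; case: (E j) => ->.
Qed.

Lemma cayley_hamilton2 (S : comNzRingType) (A : 'M[S]_2) :
  A * A = \tr A *: A - (\det A)%:M.
Proof.
apply: mx2_eq; rewrite !mxE /= !big_ord_recl !big_ord0 tr2E det2E /=;
  have -> : lift ord0 ord0 = 1 :> 'I_2 by apply: val_inj.
all: rewrite -!/(0 : 'I_2) ?mulr1n ?mulr0n; ring.
Qed.

(* By Cayley-Hamilton [A ^+ k = a *: A + b] with [a * x + b = x ^+ k] at both
   eigenvalues [x]. *)
Lemma det_expr_sub1 (S : comNzRingType) (A : 'M[S]_2) (l m : S) k :
  l + m = \tr A -> l * m = \det A ->
  \det (A ^+ k - 1) = (l ^+ k - 1) * (m ^+ k - 1).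
Proof.
move=> tE dE.
have [a [b [-> <- <-]]] : exists a b,
    [/\ A ^+ k = a *: A + b%:M, a * l + b = l ^+ k & a * m + b = m ^+ k].
  elim: k => [|k [a [b [IA Il Im]]]].
    by exists 0, 1; rewrite scale0r !mul0r !add0r !expr0.
  exists (a * \tr A + b), (- a * \det A); split.
  - rewrite exprSr IA mulrDl -scalerAl cayley_hamilton2 scalerBr scalerA.
    rewrite mulNr scale_scalar_mx -[b%:M * A]/(b%:M *m A) mul_scalar_mx.
    by rewrite scalerDl raddfN /= addrAC.
  - by rewrite exprSr -Il -tE -dE; ring.
  - by rewrite exprSr -Im -tE -dE; ring.
rewrite det2E !mxE /= ?mulr1n ?mulr0n.
have : l * m = A 0 0 * A 1 1 - A 0 1 * A 1 0 by rewrite dE det2E.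
have : l + m = A 0 0 + A 1 1 by rewrite tE tr2E.
move=> sE pE.
have -> : (a * l + b - 1) * (a * m + b - 1)
   = a * a * (l * m) + a * (b - 1) * (l + m) + (b - 1) * (b - 1) by ring.
by rewrite sE pE; ring.
Qed.

(** Two roots of modulus at most 1 force [|d| <= 1] and [|t| <= 2]; the finitely many pairs left are
    excluded by the list, by [- t + d + 1 != 0], or as not arising from such roots. *)
Lemma root_norm_gt1 (l m : algC) (t d : int) : l + m = t%:~R -> l * m = d%:~R ->
  - t + d + 1 != 0 ->
  (t, d) \notin [:: (0, 0); (-1, 0); (-2, 1); (0, 1); (-1, 1); (1, 1)] ->
  1 < `|l| \/ 1 < `|m|.
Proof.
move=> tE dE hL htd.
have [l1|] := real_leP (normr_real l) (@real1 _); last by left.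
have [m1|] := real_leP (normr_real m) (@real1 _); last by right.
exfalso.
have dle : `|d| <= 1.
  rewrite -(ler_int algC) intr_norm -dE normrM.
  by rewrite mulr_ile1.
have tle : `|t| <= 2.
  rewrite -(ler_int algC) intr_norm -tE.
  by rewrite (le_trans (ler_normD _ _)) // (lerD l1 m1).
have E : (d = 0 \/ d = 1) \/ d = -1 by lia.
case: E => [[E|E]|E]; subst d.
- have : t = 0 \/ t = 1 \/ t = -1 \/ 1 < `|t| by lia.
  case=> [E|[E|[E|E]]]; try by subst t.
  move/eqP: dE; rewrite mulf_eq0 => /orP[/eqP z|/eqP z].
    rewrite z add0r in tE; move: m1; rewrite tE -intr_norm lerz1; lia.
  rewrite z addr0 in tE; move: l1; rewrite tE -intr_norm lerz1; lia.
- have : t = 0 \/ t = 1 \/ t = -1 \/ t = 2 \/ t = -2 by lia.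
  by case=> [E|[E|[E|[E|E]]]]; subst t.
(* For [d = -1] both moduli are 1, so the conjugate of [l] is its inverse, [- m]. The real number
   [l + m] is then its own opposite, and [t = 0] contradicts [hL]. *)
- have nlm : `|l| * `|m| = 1 by rewrite -normrM dE normrN1.
  have nl : `|l| = 1.
    by apply/le_anti; rewrite l1 -nlm ler_piMr.
  have lN0 : l != 0 by rewrite -normr_eq0 nl oner_eq0.
  have cl : l^* = - m.
    apply: (mulfI lN0); rewrite -normCK nl expr1n mulrN dE.
    by rewrite mulrN1z opprK.
  have tc : (t%:~R : algC)^* = t%:~R by rewrite rmorph_int.
  have : (t%:~R : algC) = 0.
    move: tc; rewrite -tE rmorphD /= cl.
    have -> : m^* = - l by rewrite -[l]conjCK cl rmorphN opprK.
    move=> h; have : (l + m) *+ 2 = 0 by rewrite mulr2n -{1}h; ring.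
    by move/eqP; rewrite mulrn_eq0 /= => /eqP.
  by move/eqP; rewrite intr_eq0 => /eqP tz; subst t.
Qed.

Lemma bernoulli (x : algC) k : 1 <= x -> k%:R * (x - 1) <= x ^+ k - 1.
Proof.
move=> x1; elim: k => [|k IH]; first by rewrite mul0r subrr.
rewrite exprS -natr1.
have : 0 <= (x - 1) * (x ^+ k - 1).
  by rewrite mulr_ge0 ?subr_ge0 ?exprn_ege1.
move=> h.
have -> : x * x ^+ k - 1 = (x ^+ k - 1 + (x - 1)) + (x - 1) * (x ^+ k - 1) by ring.
by rewrite mulrDl mul1r ler_wpDr // lerD.
Qed.

(** The factor [l ^+ k - 1] grows at least linearly by Bernoulli's inequality, while [m ^+ k - 1]
    stays away from 0; taking [k] odd handles the case [m = -1]. *)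
Lemma eigen_growth (l m : algC) (t d : int) (N : int) :
  l + m = t%:~R -> l * m = d%:~R ->
  - t + d + 1 != 0 -> 1 < `|l| ->
  exists K, forall k, (K <= k)%N -> odd k ->
    N%:~R < `|(l ^+ k - 1) * (m ^+ k - 1)|.
Proof.
move=> tE dE hL l1.
have [c c0 cP] : exists2 c : algC, 0 < c & forall k, odd k -> c <= `|m ^+ k - 1|.
  have [mr1|/negP m1] := boolP (`|m| == 1).
    (* The conjugate of [m] is a root of the same real polynomial, hence [l] or [m]; its modulus 1
       excludes [l]. So [m] is 1 or -1, and [hL] excludes 1. *)
    have mc : m^* = m.
      have : (m^* - l) * (m^* - m) = 0.
        have -> : (m^* - l) * (m^* - m) = m^* * m^* - (l + m) * m^* + l * m by ring.
        have sC : (l + m)^* = l + m by rewrite tE rmorph_int.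
        have pC : (l * m)^* = l * m by rewrite dE rmorph_int.
        rewrite -sC -pC -!rmorphM -rmorphB -rmorphD /=.
        by rewrite (_ : _ - _ + _ = 0) ?rmorph0 //; ring.
      move/eqP; rewrite mulf_eq0 !subr_eq0 => /orP[/eqP e|/eqP//].
      by move: l1; rewrite -e norm_conjC (eqP mr1) ltxx.
    have : m * m = 1 by rewrite -{2}mc -normCK (eqP mr1) expr1n.
    move/eqP; rewrite -subr_eq0 -[X in _ - X](mulr1 1).
    have -> : m * m - 1 * 1 = (m - 1) * (m + 1) by ring.
    rewrite mulf_eq0 subr_eq0 addr_eq0 => /orP[/eqP e|/eqP e].
      exfalso; move/negP: hL; apply; rewrite -(intr_eq0 algC).
      by rewrite !(rmorphD, rmorphN) /= -tE -dE e; apply/eqP; ring.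
    exists 2 => [|k ko]; first exact: ltr0n.
    rewrite e -signr_odd ko expr1 -opprD normrN.
    by rewrite -[1 + 1]/(2%:R) normr_nat.
  (* By the reverse triangle inequality, and because the powers of a number in [0, 1] or above 1
     move away from 1. *)
  exists (`| `|m| - 1|).
    by rewrite normr_gt0 subr_eq0; apply/negP.
  move=> k ko.
  have k0 : (0 < k)%N by case: k ko.
  apply: le_trans (ler_dist_dist _ _); rewrite normr1 normrX.
  have [m1'|m1'] := real_leP (@real1 _) (normr_real m).
    rewrite ![`|_ - 1|]ger0_norm ?subr_ge0 ?exprn_ege1 //.
    by rewrite lerD2r (ler_eXnr k0 m1').
  have mk : `|m| ^+ k <= `|m| by rewrite ler_iXnr // ltW.
  rewrite (distrC (_ ^+ k)) [`|1 - _|]ger0_norm ?subr_ge0.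
    by rewrite lerD2l lerN2.
  exact: le_trans mk (ltW m1').
(* Once [k] exceeds [b], the lower bound [c * (k * (|l| - 1))] of the product exceeds [|N|]. *)
pose b := (c * (`|l| - 1))^-1 * `|N|%:~R.
have c0' : 0 < c * (`|l| - 1) by rewrite mulr_gt0 ?subr_gt0.
exists (Num.bound b) => k Kk ko.
rewrite normrM mulrC.
have h1 : k%:R * (`|l| - 1) <= `|l ^+ k - 1|.
  apply: le_trans (bernoulli _ _ (ltW l1)) _.
  rewrite -normrX -[X in _ - X](@normr1 algC).
  by rewrite lerB_dist.
have h2 : 0 <= k%:R * (`|l| - 1) :> algC by rewrite mulr_ge0 // subr_ge0 ltW.
apply: lt_le_trans (ler_pM (ltW c0) h2 (cP k ko) h1).
apply: (@le_lt_trans _ _ `|N|%:~R); first by rewrite ler_int ler_norm.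
rewrite mulrCA -ltr_pdivrMr //  mulrC.
apply: (@lt_le_trans _ _ (Num.bound b)%:R); last by rewrite ler_nat.
apply: le_lt_trans (archi_boundP _).
  by [].
by rewrite mulr_ge0 // ?invr_ge0 ?ltW // ler0z.
Qed.

Lemma det_expr_sub1_growth (A : 'M[int]_2) (N : int) :
  - \tr A + \det A + 1 != 0 ->
  (\tr A, \det A) \notin
    [:: (0, 0); (-1, 0); (-2, 1); (0, 1); (-1, 1); (1, 1)] ->
  exists K, forall k, (K <= k)%N -> odd k -> N < `|\det (A ^+ k - 1)|.
Proof.
set t := \tr A; set d := \det A => hL htd.
have [l [m [lmt lmd]]] : exists l m : algC, l + m = t%:~R /\ l * m = d%:~R.
  pose s := sqrtC ((t%:~R) ^+ 2 - 4 * d%:~R : algC).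
  exists ((t%:~R + s) / 2), ((t%:~R - s) / 2); split.
    by field.
  have : s ^+ 2 = (t%:~R) ^+ 2 - 4 * d%:~R by rewrite sqrtCK.
  move=> sE.
  have -> : (t%:~R + s) / 2 * ((t%:~R - s) / 2) = ((t%:~R) ^+ 2 - s ^+ 2) / 4
    by field.
  by rewrite sE; field.
wlog l1 : l m lmt lmd / 1 < `|l|.
  move=> H; have [l1|m1] := root_norm_gt1 l m t d lmt lmd hL htd.
    exact: (H l m).
  by apply: (H m l) => //; rewrite 1?addrC // mulrC.
have [K KP] := eigen_growth l m t d N lmt lmd hL l1.
exists K => k Kk ko; rewrite -(ltr_int algC) intr_norm.
have := KP k Kk ko; congr (_ < `|_|).
rewrite -(det_expr_sub1 _ (map_mx intr A)).
- by rewrite -[RHS]det_map_mx /= map_mxB map_mx1 rmorphXn.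
- by rewrite lmt -trace_map_mx.
- by rewrite lmd -det_map_mx.
Qed.

(** Preimages of the standard basis rows would be the rows of an integer matrix [U] with
    [U *m B = 1], and then [|\det B|] would be at most 1. *)
Lemma int_det_gt1_not_surj n (B : 'M[int]_n) :
  1 < `|\det B| -> exists v : 'rV[int]_n, forall u, v <> u *m B.
Proof.
move=> B1; have [//|nv] := pselect (exists v : 'rV[int]_n, forall u, v <> u *m B).
have surj (v : 'rV[int]_n) : exists u, v == u *m B.
  have [[u ->]|nu] := pselect (exists u, v = u *m B); first by exists u.
  by case: nv; exists v => u e; apply: nu; exists u.
pose U := \matrix_i (xchoose (surj (row i 1%:M))).
have UB : U *m B = 1%:M.
  by apply/row_matrixP => i; rewrite row_mul rowK -(eqP (xchooseP (surj _))).
have UB1 : `|\det U| * `|\det B| = 1 by rewrite -normrM -det_mulmx UB det1 normr1.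
have U1 : 1 <= `|\det U|.
  rewrite -gtz0_ge1 normr_gt0; apply/eqP => U0.
  by move/eqP: UB1; rewrite U0 normr0 mul0r.
by move: B1; rewrite ltNge -UB1 ler_peMl.
Qed.

End Growth.

(** * Lifting maps to R/Z *)

Section Mod1.
Local Open Scope classical_set_scope.
Local Open Scope ring_scope.
Context {R : realType}.

(** Continuity as a map to R/Z: [phi] may jump by integers, as the coordinates of a chosen
    representative do. *)
Definition mod1_continuous (T : topologicalType) (phi : T -> R) :=
  forall (x : T) (e : R), 0 < e ->
    \forall y \near x, exists z : int, `|phi y - phi x - z%:~R| < e.

(** The representative of [a] modulo 1 in [-1/2, 1/2). *)
Definition centered_frac (a : R) : R := a - (Num.floor (a + 2^-1))%:~R.

Lemma centered_frac_eq (a : R) (z : int) : `|a - z%:~R| < 2^-1 ->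
  centered_frac a = a - z%:~R.
Proof.
move=> h; rewrite /centered_frac (@floor_def _ _ z) //.
move: h; rewrite ltr_norml => /andP[h1 h2]; rewrite intrD; lra.
Qed.

Lemma centered_frac0 : centered_frac 0 = 0.
Proof. by rewrite (@centered_frac_eq 0 0) subrr // normr0 invr_gt0 ltr0n. Qed.

Lemma centered_fracP (a : R) : exists z : int, centered_frac a = a - z%:~R.
Proof. by eexists. Qed.

Lemma near_int_le (a : R) (z : int) (e : R) :
  `|a - z%:~R| < e -> e <= 2^-1 -> `|centered_frac a| < e.
Proof. by move=> h he; rewrite (@centered_frac_eq a z) //; apply: lt_le_trans he. Qed.

(** [centered_frac] jumps only at half-integers, and the bound 1/4 keeps the difference away from
    them. *)
Lemma centered_frac_cvg (T U : topologicalType) (phi : T -> R) (p q : U -> T)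
  (x : U) :
  mod1_continuous T phi -> {for x, continuous p} -> {for x, continuous q} ->
  `|centered_frac (phi (p x) - phi (q x))| < 4^-1 ->
  {for x, continuous (fun y => centered_frac (phi (p y) - phi (q y)))}.
Proof.
move=> cphi cp cq h4; apply/cvgrPdist_lt => e e0.
(* Two errors below [d] add up to less than [e] and to less than 1/8, so that 1/4 plus both stays
   below the jump at 1/2. *)
pose d := Num.min e (8^-1) / 2.
have d0 : 0 < d by rewrite divr_gt0 // lt_min e0 invr_gt0 ltr0n.
have de : d <= e / 2 by rewrite ler_pM2r ?invr_gt0 ?ltr0n // ge_min lexx.
have d8 : d <= 8^-1 / 2 by rewrite ler_pM2r ?invr_gt0 ?ltr0n // ge_min lexx orbT.
have hp := cp _ (cphi (p x) _ d0); have hq := cq _ (cphi (q x) _ d0).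
near=> y.
have [z1 h1] : exists z : int, `|phi (q y) - phi (q x) - z%:~R| < d by near: y.
have [z2 h2] : exists z : int, `|phi (p y) - phi (p x) - z%:~R| < d by near: y.
have [z0 E] := centered_fracP (phi (p x) - phi (q x)).
rewrite (@centered_frac_eq (phi (p y) - phi (q y)) (z2 - z1 + z0)).
  move: h1 h2; rewrite E intrD intrB !ltr_norml => /andP[? ?] /andP[? ?].
  by apply/andP; split; lra.
move: h4 h1 h2; rewrite E intrD intrB !ltr_norml => /andP[? ?] /andP[? ?] /andP[? ?].
by apply/andP; split; lra.
Unshelve. all: by end_near. Qed.

(** If the end values differed, the intermediate value theorem would produce the value [g 0 + 1/2],
    up to replacing [g] by its opposite. *)
Lemma int_valued_segment (g : R -> R) :
  continuous g ->
  (forall t, 0 <= t <= 1 -> exists z : int, g t = z%:~R) -> g 0 = g 1.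
Proof.
move=> cg gZ.
wlog g01 : g cg gZ / g 0 <= g 1.
  move=> H; have [|/ltW g10] := leP (g 0) (g 1); first exact: H.
  apply: oppr_inj; apply: (H (- g)).
  - by move=> x; apply: continuousN; exact: cg.
  - by move=> t /gZ[z E]; exists (- z); rewrite fctE E mulrNz.
  - by rewrite !fctE lerN2.
have [z0 E0] := gZ 0 (ltac:(by rewrite lexx ler01)).
have [z1 E1] := gZ 1 (ltac:(by rewrite lexx ler01)).
move: g01; rewrite le_eqVlt => /orP[/eqP//|lt01].
have lez : z0 + 1 <= z1 by rewrite lezD1 -(ltr_int R) -E0 -E1.
have {}lez : z0%:~R + 1 <= z1%:~R :> R by rewrite -[1]/(1%:~R) -intrD ler_int.
have [||c cI Ec] := @IVT R g 0 1 (g 0 + 2^-1) ler01.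
- exact: continuous_subspaceT.
- by rewrite (min_idPl (ltW lt01)) (max_idPr (ltW lt01)) E1 E0; apply/andP;
  split; lra.
have [z Ez] := gZ c cI.
have : (z0%:~R : R) < z%:~R by rewrite -Ez Ec E0; lra.
have : (z%:~R : R) < (z0 + 1)%:~R by rewrite -Ez Ec E0 intrD; lra.
by rewrite !ltr_int ltzD1 => /le_lt_trans h /h; rewrite ltxx.
Qed.

(** Retraction of the line onto [0, 1]: paths and homotopies given on the segment become maps on the
    whole line or plane, where lifting is available. *)
Definition clamp (t : R) : R := Num.min 1 (Num.max 0 t).

Lemma clamp_itv t : 0 <= clamp t <= 1.
Proof. by rewrite /clamp le_min ler01 le_max lexx /= ge_min lexx. Qed.

Lemma clamp_id t : 0 <= t <= 1 -> clamp t = t.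
Proof. by move=> /andP[t0 t1]; rewrite /clamp (max_idPr t0) (min_idPr t1). Qed.

Lemma clamp_continuous : continuous clamp.
Proof.
move=> t; apply: continuous_min; first exact: cvg_cst.
by apply: continuous_max; [exact: cvg_cst|exact: cvg_id].
Qed.

Section Lift.
Context (n : nat) (phi : 'rV[R]_n -> R) (cphi : mod1_continuous _ phi).
Local Notation V := 'rV[R]_n.

(** Heine's theorem for maps to R/Z, from compactness of the closed ball. *)
Lemma mod1_unif_continuous (r : R) : exists2 d : R, 0 < d &
  forall x y : V, `|x| <= r -> `|x - y| < d -> `|centered_frac (phi y - phi x)| <
    4^-1.
Proof.
have cK : compact [set x : V | `|x| <= r].
  apply: bounded_closed_compact.
    by exists r; split=> [|s rs x /= xr]; rewrite ?num_real // (le_trans xr) // ltW.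
  have := @closed_comp V R (fun x => `|x|) [set y | y <= r].
  by apply; [move=> x _; exact: norm_continuous|exact: closed_le].
have /compact_near_coveringP cov := cK.
have /(_ (0^'+) (fun d x => forall y, `|x - y| < d ->
  `|centered_frac (phi y - phi x)| < 4^-1)) := cov R.
have FF : Filter (0^'+ : set_system R) by exact: _.
move=> /(_ FF); case.
  move=> x xr.
  have e0 : 0 < 8^-1 :> R by rewrite invr_gt0 ltr0n.
  have /nbhs_ballP[e /= e0' he] := cphi x _ e0.
  (* Halving [e] keeps both [x'] and [y] in the ball of radius [e] around [x]. *)
  exists (ball x (e / 2), [set d | d < e / 2]).
    split; first by apply: nbhsx_ballx; rewrite divr_gt0.
    by apply: nbhs_right_lt; rewrite divr_gt0.
  move=> [x' d] /= [xx' de] y x'y.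
  move: xx'; rewrite -ball_normE /= => xx'.
  have [z1 h1] : exists z : int, `|phi x' - phi x - z%:~R| < 8^-1.
    by apply: he; rewrite -ball_normE /=; apply: lt_le_trans xx' _; lra.
  have [z2 h2] : exists z : int, `|phi y - phi x - z%:~R| < 8^-1.
    apply: he; rewrite -ball_normE /=.
    by have := ler_distD x' x y; lra.
  apply: (@near_int_le _ (z2 - z1)); last by lra.
  move: h1 h2; rewrite intrB !ltr_norml => /andP[? ?] /andP[? ?].
  by apply/andP; split; lra.
move=> d /= d0 hd; exists (d / 2); first by rewrite divr_gt0.
move=> x y xr xy; apply: (hd (d / 2)) => //=; last by rewrite divr_gt0.
by rewrite sub0r normrN gtr0_norm ?divr_gt0 //; lra.
Qed.

(* Add up the small increments of [phi] along the ray to [x]. *)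
Lemma mod1_lift_ball (r : R) : exists Phi : V -> R,
  [/\ forall x, `|x| <= r -> {for x, continuous Phi},
      forall x, exists z : int, Phi x = phi x + z%:~R & Phi 0 = phi 0].
Proof.
wlog r0 : r / 0 < r.
  move=> H; have [Phi [h1 h2 h3]] :=
    H (Num.max r 1) (ltac:(by rewrite lt_max ltr01 orbT)).
  by exists Phi; split => // x xr; apply: h1; rewrite le_max xr.
have [d d0 hd] := mod1_unif_continuous r.
(* Cutting the ray into [N] pieces makes each step at most [r / N < d], so every increment is below
   1/4 modulo 1. *)
pose N := (Num.bound (r / d)).+1.
have N0 : 0 < N%:R :> R by rewrite ltr0n.
have rN : r / N%:R < d.
  rewrite ltr_pdivrMr // mulrC -ltr_pdivrMr //.
  by rewrite (lt_le_trans (archi_boundP _)) ?divr_ge0 ?(ltW r0) ?(ltW d0) // ler_nat.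
pose p i (x : V) := (i%:R / N%:R) *: x.
exists (fun x => phi 0 + \sum_(i < N) centered_frac
  (phi (p i.+1 x) - phi (p i x))); split.
- move=> x xr.
  have cp i : {for x, continuous (p i)} by exact: scaler_continuous.
  pose S (i : 'I_N) (x : V) := centered_frac (phi (p i.+1 x) - phi (p i x)).
  suff cS : \sum_(i < N) S i y @[y --> x] --> \sum_(i < N) S i x.
    exact: (cvgD (cvg_cst (phi 0)) cS).
  apply: (@cvg_big R 'I_N +%R 0 xpredT (@add_continuous R) V (nbhs x)).
  + move=> i _; apply: centered_frac_cvg => //.
    apply: hd.
      rewrite normrZ -[leRHS]mul1r ler_pM // ger0_norm ?divr_ge0 //.
      by rewrite ler_pdivrMr // mul1r ler_nat ltnW.
    rewrite -scalerBl normrZ -natr1 mulrDl opprD addrA subrr sub0r normrN.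
    rewrite mul1r gtr0_norm ?invr_gt0 //.
    by rewrite mulrC (le_lt_trans _ rN) // ler_pM2r ?invr_gt0.
- move=> x.
  (* Modulo integers the sum telescopes. *)
  have : forall m, exists z : int,
     phi 0 + \sum_(i < m) centered_frac (phi (p i.+1 x) - phi (p i x)) = phi
       (p m x) + z%:~R.
    elim=> [|m [z IH]].
      by exists 0; rewrite big_ord0 /p mul0r scale0r.
    have [z' E] := centered_fracP (phi (p m.+1 x) - phi (p m x)).
    exists (z - z'); rewrite big_ord_recr /= addrA IH E intrB; ring.
  move=> /(_ N)[z ->]; exists z; congr (phi _ + _).
  by rewrite /p divff ?scale1r // gt_eqF.
- rewrite big1 ?addr0 // => i _.
  by rewrite /p !scaler0 subrr centered_frac0.
Qed.

(** Lifts on two balls agree at 0 and differ by an integer along each ray, hence agree on the common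
    ball. They are glued by using at [x] a ball whose radius strictly exceeds [|x|], so that it also
    contains the nearby points. *)
Lemma mod1_lift : exists2 Phi : V -> R, continuous Phi &
  forall x, exists z : int, Phi x = phi x + z%:~R.
Proof.
have [Phi PhiP] := choice (fun k : nat => mod1_lift_ball k%:R).
have agree k l x : `|x| <= k%:R -> `|x| <= l%:R -> Phi k x = Phi l x.
  move=> xk xl.
  have [ck zk Ek] := PhiP k; have [cl zl El] := PhiP l.
  pose g t := Phi k (clamp t *: x) - Phi l (clamp t *: x).
  have cont m : `|x| <= m%:R ->
    (forall x, `|x| <= m%:R -> {for x, continuous (Phi m)}) ->
      continuous (fun t => Phi m (clamp t *: x)).
    move=> xm cm t; apply: (@continuous_comp _ _ _ (fun t => clamp t *: x) (Phi m)).
      apply: (@continuous_comp _ _ _ clamp (fun t => t *: x));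
        last exact: scalel_continuous.
      exact: clamp_continuous.
    apply: cm; rewrite normrZ; have /andP[? ?] := clamp_itv t.
    by rewrite ger0_norm // (le_trans _ xm) // ler_piMl.
  have : g 0 = g 1.
    apply: int_valued_segment.
      by move=> t; apply: cvgB; exact: cont.
    move=> t _; have [z1 E1] := zk (clamp t *: x); have [z2 E2] := zl (clamp t *: x).
    by exists (z1 - z2); rewrite /g E1 E2 intrB; ring.
  rewrite /g !clamp_id ?lexx ?ler01 // scale0r scale1r.
  by rewrite Ek El subrr => /esym/eqP; rewrite subr_eq0 => /eqP.
pose k (x : V) := Num.bound `|x|.
have kP x : `|x| < (k x)%:R by apply: archi_boundP.
exists (fun x => Phi (k x) x); last by move=> x; have [_ h _] := PhiP (k x); exact: h.
move=> x.
have [ck _ _] := PhiP (k x).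
rewrite /continuous_at; apply: cvg_trans (ck x (ltW (kP x))).
apply: near_eq_cvg; first exact: (nbhs_filter x).
have near_k : nbhs x [set y : V | `|y| < (k x)%:R].
  apply: (@norm_continuous R V x [set z | z < (k x)%:R]).
  by apply: open_nbhs_nbhs; split; [exact: open_lt|exact: kP].
apply: filterS near_k => y /= yk.
by apply: agree; apply/ltW.
Qed.

End Lift.
End Mod1.

(** * Fixed points of bounded maps of the plane *)

Section FixedPoint.
Local Open Scope classical_set_scope.
Local Open Scope ring_scope.
Context {R : realType}.

Lemma continuous_row (T : topologicalType) n (F : T -> 'rV[R]_n) (x : T) :
  (forall j, {for x, continuous (fun y => F y 0 j)}) -> {for x, continuous F}.
Proof.
move=> cF A [P nP sPA].
have H : \forall y \near x, forall j, P 0 j (F y 0 j).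
  apply: filter_forall => j.
  exact: (cF j _ (nP 0 j)).
apply: filterS H => y Py; apply: sPA => i j; rewrite ord1; exact: Py.
Qed.

Lemma continuous_coord (T : topologicalType) n (F : T -> 'rV[R]_n) (x : T) j :
  {for x, continuous F} -> {for x, continuous (fun y => F y 0 j)}.
Proof.
by move=> cF; apply: (@continuous_comp _ _ _ F (fun v : 'rV[R]_n => v 0 j)) => //;
  exact: coord_continuous.
Qed.

Lemma ord2P (P : 'I_2 -> Prop) : P 0 -> P 1 -> forall j, P j.
Proof.
move=> P0 P1 [[|[|m]] lt] //.
- by rewrite (_ : Ordinal lt = 0) //; exact: val_inj.
- by rewrite (_ : Ordinal lt = 1) //; exact: val_inj.
Qed.

Definition row2 (a b : R) : 'rV[R]_2 := \row_j (if j == 0 then a else b).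

Lemma row2_0 a b : row2 a b 0 0 = a. Proof. by rewrite mxE. Qed.
Lemma row2_1 a b : row2 a b 0 1 = b. Proof. by rewrite mxE. Qed.

Lemma row2_eq (u v : 'rV[R]_2) : u 0 0 = v 0 0 -> u 0 1 = v 0 1 -> u = v.
Proof. by move=> h0 h1; apply/rowP; apply: ord2P. Qed.

Lemma continuous_row2 (T : topologicalType) (f g : T -> R) (x : T) :
  {for x, continuous f} -> {for x, continuous g} ->
  {for x, continuous (fun y => row2 (f y) (g y))}.
Proof.
move=> cf cg; apply: continuous_row; apply: ord2P.
  by under [X in {for x, continuous X}]funext => y do rewrite row2_0.
by under [X in {for x, continuous X}]funext => y do rewrite row2_1.
Qed.

(** The l^1 norm replaces the Euclidean one so that angles need no trigonometry. *)
Definition norm1 (u : 'rV[R]_2) : R := `|u 0 0| + `|u 0 1|.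

Lemma norm1_gt0 u : u != 0 -> 0 < norm1 u.
Proof.
move=> u0; rewrite lt_def addr_ge0 // andbT; apply: contra_neq u0 => /eqP.
rewrite paddr_eq0 // !normr_eq0 => /andP[/eqP h0 /eqP h1].
by apply: row2_eq; rewrite mxE.
Qed.

Lemma norm1_continuous : continuous norm1.
Proof.
move=> u.
have c j : {for u, continuous (fun v : 'rV[R]_2 => `|v 0 j|)}.
  apply: (@continuous_comp _ _ _ (fun v : 'rV[R]_2 => v 0 j) Num.norm).
    exact: coord_continuous.
  exact: norm_continuous.
exact: cvgD (c 0) (c 1).
Qed.

Definition height (u : 'rV[R]_2) : R := u 0 1 / norm1 u.

(* The angle of [u], in turns, after radial projection to the unit circle of
   the l^1 norm. *)
Definition angle (u : 'rV[R]_2) : R :=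
  if 0 <= u 0 0 then height u / 4 else 2^-1 - height u / 4.

Lemma height_continuous (u : 'rV[R]_2) : u != 0 -> {for u, continuous height}.
Proof.
move=> u0; have n0 : norm1 u != 0 by rewrite gt_eqF // norm1_gt0.
exact: cvgM (@coord_continuous R 1 2 0 1 u) (cvgV n0 (norm1_continuous u)).
Qed.

Lemma abs_height u : u != 0 -> `|height u| = 1 - `|u 0 0| / norm1 u.
Proof.
move=> /norm1_gt0 u0; rewrite normrM normfV (gtr0_norm u0).
have : norm1 u != 0 by rewrite gt_eqF.
rewrite /norm1 => h; field; exact: h.
Qed.

(** Off the vertical axis a single branch of [angle] is met nearby. On the axis the two branches
    agree at height 1 and differ by exactly 1 at height -1. *)
Lemma angle_mod1 (u : 'rV[R]_2) (e : R) : u != 0 -> 0 < e ->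
  \forall v \near u, exists z : int, `|angle v - angle u - z%:~R| < e.
Proof.
move=> u0 e0.
have hh : \forall v \near u, `|height u - height v| < e.
  exact: (cvgr_dist_lt _ _ (height_continuous u u0)).
have [up|un|uz] := ltgtP (u 0 0) 0.
- have hn : nbhs u [set v : 'rV[R]_2 | v 0 0 < 0].
    apply: (@coord_continuous R 1 2 0 0 u [set z | z < 0]).
    by apply: open_nbhs_nbhs; split => //; exact: open_lt.
  near=> v; exists 0; rewrite /angle !leNgt up (_ : v 0 0 < 0) /=; last by near: v.
  have : `|height u - height v| < e by near: v.
  by rewrite !ltr_norml => /andP[? ?]; apply/andP; split; lra.
- have hn : nbhs u [set v : 'rV[R]_2 | 0 < v 0 0].
    apply: (@coord_continuous R 1 2 0 0 u [set z | 0 < z]).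
    by apply: open_nbhs_nbhs; split => //; exact: open_gt.
  near=> v; exists 0; rewrite /angle !ltW //; last by near: v.
  have : `|height u - height v| < e by near: v.
  by rewrite !ltr_norml => /andP[? ?]; apply/andP; split; lra.
- near=> v.
  have : `|height u - height v| < e by near: v.
  rewrite ltr_norml => /andP[h1 h2].
  have h3 : `|height u| = 1 by rewrite abs_height // uz normr0 mul0r subr0.
  rewrite /angle uz lexx; have [hu|hu] := leP 0 (height u).
    rewrite ger0_norm // in h3; exists 0.
    by case: ifP => _; rewrite ltr_norml; apply/andP; split; lra.
  rewrite ltr0_norm // in h3.
  case: ifP => _; [exists 0|exists 1]; rewrite ltr_norml ?mulr1z ?mulr0z;
    by apply/andP; split; lra.
Unshelve. all: by end_near. Qed.

(** Angles lie in [-1/4, 3/4), so [z = 0]. Equal angles then give the same half-plane and the same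
    height, hence the same point of the l^1 circle. *)
Lemma angle_eq_mod1 (u v : 'rV[R]_2) (z : int) : u != 0 -> v != 0 ->
  angle u = angle v + z%:~R -> exists2 c : R, 0 < c & u = c *: v.
Proof.
move=> u0 v0 E.
have bound (w : 'rV[R]_2) : w != 0 -> - 4^-1 <= angle w < 3 / 4.
  move=> w0; have := abs_height w w0; have := norm1_gt0 w w0.
  rewrite /angle => n0 hE; case: ifPn => [w00|]; last first.
    rewrite -ltNge => w00.
    have : `|height w| < 1.
      by rewrite hE ltrBlDr ltrDl divr_gt0 // normr_gt0 lt_eqF.
    by rewrite ltr_norml => /andP[? ?]; apply/andP; split; lra.
  have : `|height w| <= 1 by rewrite hE lerBlDr lerDl divr_ge0 // ltW.
  by rewrite ler_norml => /andP[? ?]; apply/andP; split; lra.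
have /andP[? ?] := bound u u0; have /andP[? ?] := bound v v0.
have z0 : z = 0.
  have : (z%:~R : R) < 1%:~R by rewrite mulr1z; lra.
  have : (-1)%:~R < (z%:~R : R) by rewrite mulrN1z; lra.
  rewrite !ltr_int => h1 h2; lia.
rewrite z0 addr0 in E.
have nu := norm1_gt0 u u0; have nv := norm1_gt0 v v0.
have hu := abs_height u u0; have hv := abs_height v v0.
have neg_lt (w : 'rV[R]_2) : w != 0 -> w 0 0 < 0 -> `|height w| < 1.
  move=> w0 w00; rewrite (abs_height w w0) ltrBlDr ltrDl divr_gt0 ?norm1_gt0 //.
  by rewrite normr_gt0 lt_eqF.
have le1 (w : 'rV[R]_2) : w != 0 -> `|height w| <= 1.
  by move=> w0; rewrite (abs_height w w0) lerBlDr lerDl divr_ge0 // ltW ?norm1_gt0.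
have [sE hE] : ((0 <= u 0 0) = (0 <= v 0 0)) /\ height u = height v.
  move: E; rewrite /angle.
  case: (leP 0 (u 0 0)) => su; case: (leP 0 (v 0 0)) => sv E.
  - by split=> //; lra.
  - have := neg_lt v v0 sv; have := le1 u u0.
    by rewrite ltr_norml ler_norml => /andP[? ?] /andP[? ?]; lra.
  - have := neg_lt u u0 su; have := le1 v v0.
    by rewrite ltr_norml ler_norml => /andP[? ?] /andP[? ?]; lra.
  - by split=> //; lra.
exists (norm1 u / norm1 v); first exact: divr_gt0.
have nu' : norm1 u != 0 by rewrite gt_eqF.
have nv' : norm1 v != 0 by rewrite gt_eqF.
have aE : `|u 0 0| / norm1 u = `|v 0 0| / norm1 v.
  by move: hu hv; rewrite hE => -> /addrI/oppr_inj.
have pE : u 0 0 / norm1 u = v 0 0 / norm1 v.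
  case: (leP 0 (u 0 0)) sE aE => su /esym.
    by move=> sv; rewrite !ger0_norm.
  by move/negbT; rewrite -ltNge => sv; rewrite !ltr0_norm // !mulNr => /oppr_inj.
apply: row2_eq; rewrite mxE.
  by rewrite mulrAC -mulrA -pE mulrC divfK.
by rewrite mulrAC -mulrA -/(height v) -hE mulrC divfK.
Qed.

(* If [P] had no fixed point, the angle of [x - P x] would lift to a continuous
   function on the plane whose odd part vanishes somewhere on a large circle;
   there [x - P x] and [- x - P (- x)] are parallel, which is absurd. *)
Lemma bounded_fixed_point (P : 'rV[R]_2 -> 'rV[R]_2) (M : R) :
  continuous P -> (forall x j, `|P x 0 j| <= M) -> exists x, P x = x.
Proof.
move=> cP bP; apply: contrapT => nfix.
pose u (x : 'rV[R]_2) := x - P x.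
have u0 x : u x != 0.
  by rewrite subr_eq0; apply/eqP => E; apply: nfix; exists x.
have cu : continuous u by move=> x; exact: cvgB (@cvg_id _ _) (cP x).
have [Phi cPhi PhiP] : exists2 Phi : 'rV[R]_2 -> R, continuous Phi &
    forall x, exists z : int, Phi x = angle (u x) + z%:~R.
  apply: (mod1_lift 2 (angle \o u)) => x e e0.
  exact: (cu x _ (angle_mod1 (u x) e (u0 x) e0)).
have M0 : 0 <= M by apply: le_trans (bP 0 0).
(* Any radius above [2 * M] works: a point with both coordinates at most [M] in modulus has l^1 norm
   at most [2 * M]. *)
pose r := 2 * M + 1.
(* The upper half of the l^1 circle of radius [r], from (r, 0) to (-r, 0). *)
pose gam t := row2 (r * (1 - 2 * t)) (r * (1 - `|1 - 2 * t|)).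
have c2 : continuous (fun t : R => 1 - 2 * t).
  move=> t; apply: cvgB; first exact: cvg_cst.
  by apply: cvgM; [exact: cvg_cst|exact: cvg_id].
have cgam : continuous gam.
  move=> t; apply: (continuous_row2 R (fun t => r * (1 - 2 * t)) (fun t =>
    r * (1 - `|1 - 2 * t|))).
    apply: cvgM; first exact: cvg_cst.
    exact: c2.
  apply: cvgM; first exact: cvg_cst.
  apply: cvgB; first exact: cvg_cst.
  apply: (@continuous_comp _ _ _ (fun t : R => 1 - 2 * t) Num.norm);
    last exact: norm_continuous.
  exact: c2.
have gam01 : gam 1 = - gam 0.
  rewrite /gam mulr0 mulr1 subr0 normr1 (_ : 1 - 2 = -1); last by ring.
  by apply: row2_eq; rewrite !mxE /= ?normrN ?normr1; ring.
pose g t := Phi (gam t) - Phi (- gam t).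
have cg : continuous g.
  move=> t; apply: cvgB; first by apply: continuous_comp; [exact: cgam|exact: cPhi].
  apply: (@continuous_comp _ _ _ (fun t => - gam t)); last exact: cPhi.
  by apply: cvgN; exact: cgam.
have gE : g 1 = - g 0 by rewrite /g gam01 opprK opprB.
have [||t tI gt0] := @IVT R g 0 1 0 ler01.
- exact: continuous_subspaceT.
- rewrite gE ge_min le_max oppr_ge0 oppr_le0.
  by case: (leP (g 0) 0) => //= h; rewrite ?h ?(ltW h) ?orbT.
set x := gam t.
have [z1 E1] := PhiP x; have [z2 E2] := PhiP (- x).
have [c c0 cE] : exists2 c : R, 0 < c & u x = c *: u (- x).
  apply: (angle_eq_mod1 _ _ (z2 - z1)) => //.
  move: gt0; rewrite /g -/x E1 E2 intrB => /eqP; rewrite subr_eq0 => /eqP; lra.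
(* The relation [cE] reads (1 + c) x = P x - c P (- x), and the coordinates of both values of [P]
   are bounded by [M]. *)
have xM j : `|x 0 j| <= M.
  have /(congr1 (fun v : 'rV_2 => v 0 j)) := cE.
  rewrite !mxE => {}cE.
  have := bP x j; have := bP (- x) j; rewrite !ler_norml => /andP[? ?] /andP[? ?].
  apply/andP; split; nra.
have : `|x 0 0| + `|x 0 1| = r.
  rewrite row2_0 row2_1 !normrM.
  have r0 : 0 <= r by rewrite /r; lra.
  rewrite (ger0_norm r0).
  have [w w1 ->] : exists2 w, `|w| <= 1 & 1 - 2 * t = w.
    exists (1 - 2 * t) => //; move: tI; rewrite in_itv /= ler_norml => /andP[? ?].
    by apply/andP; split; lra.
  by rewrite (@ger0_norm _ (1 - `|w|)) ?subr_ge0 //; ring.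
have := xM 0; have := xM 1; rewrite /r; lra.
Qed.
End FixedPoint.

(** * Lifting maps to the torus *)

Section TorusLift.
Local Open Scope classical_set_scope.
Local Open Scope ring_scope.
Context {R : realType}.
Local Notation V := 'rV[R]_2.

Definition torus_pi (x : V) : torus R := (\pi_(torus R) x)%qT.
Definition lattice_row (w : 'rV[int]_2) : V := map_mx intr w.

Lemma lattice_rowB v w : lattice_row (v - w) = lattice_row v - lattice_row w.
Proof. exact: map_mxB. Qed.
HB.instance Definition _ := GRing.isZmodMorphism.Build _ _ lattice_row lattice_rowB.
Lemma lattice_rowD v w : lattice_row (v + w) = lattice_row v + lattice_row w.
Proof. exact: map_mxD. Qed.
Lemma lattice_rowN w : lattice_row (- w) = - lattice_row w. Proof.
exact: map_mxN. Qed.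
Lemma lattice_row0 : lattice_row 0 = 0. Proof. exact: map_mx0. Qed.
Lemma lattice_rowM w (A : 'M[int]_2) : lattice_row (w *m A) = lattice_row w *m
  map_mx intr A.
Proof. exact: map_mxM. Qed.

Lemma lattice_row_inj : injective lattice_row.
Proof.
by move=> v w /rowP E; apply/rowP => j; have := E j; rewrite !mxE => /intr_inj.
Qed.

Lemma torus_pi_eq (x y : V) : torus_pi x = torus_pi y <->
  exists w, x = y + lattice_row w.
Proof.
have -> : torus_pi x = torus_pi y <-> (x - y) \in @integer_lattice R.
  change (torus_pi x = torus_pi y) with
    (\pi_(Quotient.quot (@integer_lattice R)) x
     = \pi_(Quotient.quot (@integer_lattice R)) y)%qT.
  split=> [/eqP|h]; first by rewrite -Quotient.idealrBE.
  by apply/eqP; rewrite -Quotient.idealrBE.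
split=> [/forallP h|[w ->]].
  exists (\row_j Num.floor ((x - y) 0 j)); apply/rowP => j.
  rewrite !mxE; have := h j; rewrite intrEfloor => /eqP.
  by rewrite !mxE => ->; ring.
apply/forallP => j; rewrite !mxE addrC addKr; exact: intr_int.
Qed.

Lemma torus_pi_lattice x w : torus_pi (x + lattice_row w) = torus_pi x.
Proof. by apply/torus_pi_eq; exists w. Qed.

Lemma torus_pi_repr (t : torus R) : torus_pi (repr t) = t.
Proof. exact: reprK. Qed.

Lemma torus_pi_continuous : continuous torus_pi.
Proof. exact: pi_continuous. Qed.

(** The section [repr] is discontinuous, yet continuous modulo the lattice, because the image of a
    ball is open in the torus. *)
Lemma near_repr (x : V) (e : R) : 0 < e ->
  \forall t \near torus_pi x, exists w : 'rV[int]_2,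
    forall j, `|(repr t : V) 0 j - x 0 j - (w 0 j)%:~R| < e.
Proof.
move=> e0.
pose U := [set t : torus R | exists2 y : V, ball x e y & torus_pi y = t].
have oU : open U.
  rewrite /open /= /quotient_open.
  (* The preimage of [U] is the union of the lattice translates of the ball. *)
  suff -> : (\pi_(torus R)%qT : V -> torus R) @^-1` U =
      \bigcup_(w in [set: 'rV[int]_2]) ((fun y : V => y - lattice_row w) @^-1`
        ball x e).
    apply: bigcup_open => w _; apply: open_comp; last exact: ball_open.
    by move=> y _; exact: (@cvgB R V V (nbhs y) _ id (cst (lattice_row w)) _ _
      cvg_id (cvg_cst _)).
  apply/seteqP; split=> y /=.
    move=> [y' By' /esym/torus_pi_eq[w E]]; exists w => //=.
    by rewrite E addrK.
  move=> [w _ /= By]; exists (y - lattice_row w) => //.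
  by rewrite -lattice_rowN torus_pi_lattice.
have Ux : U (torus_pi x) by exists x => //; exact: ballxx.
have nU : nbhs (torus_pi x) U by apply: open_nbhs_nbhs.
apply: filterS nU => t [y By yt].
have [w E] : exists w, (repr t : V) = y + lattice_row w.
  by apply/torus_pi_eq; rewrite torus_pi_repr.
exists w => j; rewrite E !mxE.
have [_ /(_ 0 j)] := By; rewrite -ball_normE /= distrC => h.
by rewrite (_ : _ - _ - _ = y 0 j - x 0 j) //; ring.
Qed.

(** Each coordinate of [repr (g x)] is continuous modulo 1, so [mod1_lift] applies to the
    coordinates separately. *)
Lemma torus_lift n (g : 'rV[R]_n -> torus R) : continuous g ->
  exists2 G : 'rV[R]_n -> V, continuous G & forall x, torus_pi (G x) = g x.
Proof.
move=> cg.
have lift1 (j : 'I_2) : exists Phi : 'rV[R]_n -> R, continuous Phi /\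
    forall x, exists z : int, Phi x = (repr (g x) : V) 0 j + z%:~R.
  have [|Phi cPhi PhiP] := mod1_lift n (fun x => (repr (g x) : V) 0 j).
    move=> x e e0.
    have h := near_repr (repr (g x)) e e0; rewrite torus_pi_repr in h.
    have {}h : nbhs x (g @^-1` _) := cg x _ h.
    by apply: filterS h => y [w /(_ j)]; exists (w 0 j).
  by exists Phi.
have [G GP] := choice lift1.
exists (fun x => \row_j G j x).
  move=> x; apply: continuous_row => j.
  under [X in {for x, continuous X}]funext => y do rewrite mxE.
  by have [cG _] := GP j; exact: cG.
move=> x; rewrite -[RHS]torus_pi_repr; apply/torus_pi_eq.
have [w wP] := choice (fun j => (GP j).2 x).
by exists (\row_j w j); apply/rowP => j; rewrite !mxE wP.
Qed.

Lemma path_lift (g : R -> torus R) : continuous g ->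
  exists2 G : R -> V, continuous G & forall t, torus_pi (G t) = g t.
Proof.
move=> cg.
have [|G cG GP] := torus_lift 1 (fun x => g (x 0 0)).
  move=> x; apply: (@continuous_comp _ _ _ (fun x : 'rV[R]_1 => x 0 0) g);
    last exact: cg.
  exact: coord_continuous.
exists (fun t => G (\row_j t)) => [t|t]; last by rewrite GP mxE.
apply: (@continuous_comp _ _ _ (fun t => \row_j t) G); last exact: cG.
apply: continuous_row => j.
by under [X in {for t, continuous X}]funext => y do rewrite mxE; exact: cvg_id.
Qed.

(** The coordinates of [G - G'] are integer valued on the segment, hence equal at its ends. *)
Lemma lift_increment (G G' : R -> V) : continuous G -> continuous G' ->
  (forall t, 0 <= t <= 1 -> torus_pi (G t) = torus_pi (G' t)) ->
  G 1 - G 0 = G' 1 - G' 0.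
Proof.
move=> cG cG' E; apply/rowP => j.
pose g t := G t 0 j - G' t 0 j.
have : g 0 = g 1.
  apply: int_valued_segment.
    move=> t; exact: cvgB (continuous_coord _ _ _ _ j (cG t))
      (continuous_coord _ _ _ _ j (cG' t)).
  move=> t /E /torus_pi_eq[w Ew]; exists (w 0 j); rewrite /g Ew !mxE; ring.
rewrite /g !mxE; lra.
Qed.

Lemma lattice_valued_cst (G : V -> V) : continuous G ->
  (forall x, exists w, G x = lattice_row w) -> forall x y, G x = G y.
Proof.
move=> cG GP x y; apply/rowP => j.
have := int_valued_segment (fun t => G (x + t *: (y - x)) 0 j).
rewrite scale0r addr0 scale1r (addrC x) subrK; apply.
  move=> t; apply: (continuous_coord R 2 (fun t : R => G (x + t *: (y - x)))).
  apply: (@continuous_comp R V V (fun t : R => x + t *: (y - x)) G); last exact: cG.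
  exact: cvgD (cvg_cst x) (@scalel_continuous R V (y - x) t).
by move=> t _; have [w ->] := GP (x + t *: (y - x)); exists (w 0 j); rewrite mxE.
Qed.

Lemma additive_row_matrix n m (c : {additive 'rV[int]_n -> 'rV[int]_m}) w :
  c w = w *m \matrix_i c (delta_mx 0 i).
Proof.
rewrite {1}(row_sum_delta w) raddf_sum mulmx_sum_row; apply: eq_bigr => i _.
by rewrite rowK -(intz (w 0 i)) !scaler_int raddfMz.
Qed.

Definition equivariant (F : V -> V) (A : 'M[int]_2) :=
  forall x w, F (x + lattice_row w) = F x + lattice_row (w *m A).

(** For fixed [w], the map F (x + w) - F x is continuous with lattice values, hence constant in [x].
    This constant is additive in [w], hence given by a matrix. *)
Lemma torus_map_lift (f : torus R -> torus R) : continuous f ->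
  exists F, exists A, [/\ continuous F, forall x, torus_pi (F x) = f (torus_pi x) &
    equivariant F A].
Proof.
move=> cf.
have [|F cF FP] := torus_lift 2 (f \o torus_pi).
  by move=> x; apply: continuous_comp; [exact: torus_pi_continuous|exact: cf].
have per w : exists v, forall x, F (x + lattice_row w) = F x + lattice_row v.
  pose G (x : V) := F (x + lattice_row w) - F x.
  have cG : continuous G.
    move=> x.
    have cFw : {for x, continuous (fun x : V => F (x + lattice_row w))}.
      apply: (@continuous_comp V V V (fun x : V => x + lattice_row w) F);
        last exact: cF.
      exact: cvgD (@cvg_id _ _) (cvg_cst _).
    exact: cvgB cFw (cF x).
  have GZ x : exists v, G x = lattice_row v.
    have /torus_pi_eq[v E] : torus_pi (F (x + lattice_row w)) = torus_pi (F x)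
      by rewrite !FP /= torus_pi_lattice.
    by exists v; rewrite /G E addrAC subrr add0r.
  have [v E] := GZ 0; exists v => x.
  by rewrite -E (lattice_valued_cst G cG GZ 0 x) /G addrCA subrr addr0.
have [c cP] := choice per.
have cB : zmod_morphism c.
  move=> v w; apply: lattice_row_inj; rewrite lattice_rowB.
  have E : F (lattice_row v) = F (lattice_row w) + lattice_row (c (v - w)).
    by rewrite -cP -lattice_rowD (addrC w) subrK.
  have E0 u : F (lattice_row u) = F 0 + lattice_row (c u) by rewrite -cP add0r.
  by apply: (addrI (F (lattice_row w)));
    rewrite -E !E0 -addrA (addrC (lattice_row (c w))) subrK.
pose cA : {additive 'rV[int]_2 -> 'rV[int]_2} :=
  HB.pack c (GRing.isZmodMorphism.Build _ _ c cB).
exists F, (\matrix_i cA (delta_mx 0 i)); split=> // x w.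
by rewrite -(additive_row_matrix _ _ cA) cP.
Qed.

Lemma continuous_mulmxr (N : 'M[R]_2) : continuous (fun x : V => x *m N).
Proof.
move=> x; apply: continuous_row => j.
under [X in {for x, continuous X}]funext => y
  do rewrite mxE big_ord_recl big_ord1 /=.
exact: cvgD (cvgM (@coord_continuous R 1 2 0 0 x) (cvg_cst _))
  (cvgM (@coord_continuous R 1 2 0 _ x) (cvg_cst _)).
Qed.

Lemma coord_le_norm n (x : 'rV[R]_n) j : `|x 0 j| <= `|x|.
Proof.
rewrite [leRHS]/Num.norm /= mx_normrE; apply/bigmax_geP; right => /=.
by exists (0, j).
Qed.

Lemma periodic_bounded (p : V -> V) : continuous p ->
  (forall x w, p (x + lattice_row w) = p x) -> exists M, forall x j, `|p x 0 j| <= M.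
Proof.
move=> cp per.
pose K := [set x : V | forall i, `[0, 1]%classic (x 0 i)].
have cK : compact K.
  apply: (@rV_compact R 2 (fun=> `[(0 : R), 1]%classic)) => _.
  exact: segment_compact.
have /compact_bounded [M [_ HM]] : compact (p @` K).
  by apply: continuous_compact => //; exact: continuous_subspaceT.
exists (M + 1) => x j.
(* Removing integer parts moves [x] into the compact unit square. *)
pose y := x + lattice_row (- \row_i Num.floor (x 0 i)).
have Ky : K y.
  move=> i; rewrite /= in_itv /= /y lattice_rowN !mxE.
  have /andP[? ?] := floor_itv (x 0 i); move: (floor_itv (x 0 i)) => /andP[h1].
  by rewrite intrD mulr1z => h2; apply/andP; split; lra.
have py : p y = p x by rewrite /y per.
have : `|p x| <= M + 1 by apply: (HM (M + 1)); [lra|exists y].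
by apply: le_trans; exact: coord_le_norm.
Qed.

(** With [p x = F x - x A] periodic, hence bounded, the equation becomes x (A - 1) = v - p x. In the
    unknown y = x (A - 1) it is a fixed point problem for a bounded map. *)
Lemma translate_solution (F : V -> V) (A : 'M[int]_2) v : continuous F ->
  equivariant F A -> \det (A - 1) != 0 -> exists x, F x = x + lattice_row v.
Proof.
move=> cF eF dA.
pose AR : 'M[R]_2 := map_mx intr A.
have Qu : AR - 1 \in unitmx.
  rewrite unitmxE unitfE.
  have -> : AR - 1 = map_mx intr (A - 1) by rewrite map_mxB map_mx1.
  by rewrite det_map_mx intr_eq0.
pose p (x : V) := F x - x *m AR.
have cp : continuous p by move=> x; exact: cvgB (cF x) (continuous_mulmxr AR x).
have [|M HM] := periodic_bounded p cp.
  by move=> x w; rewrite /p eF lattice_rowM mulmxDl opprD addrACA subrr addr0.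
have [||y yE] := bounded_fixed_point (fun y =>
  lattice_row v - p (y *m invmx (AR - 1)))
   (`|lattice_row v| + M).
- move=> y.
  have cpN : {for y, continuous (fun y : V => p (y *m invmx (AR - 1)))}.
    apply: (@continuous_comp V V V (fun y : V => y *m invmx (AR - 1)) p);
      last exact: cp.
    exact: continuous_mulmxr.
  exact: cvgB (cvg_cst _) cpN.
- move=> y j;
  rewrite mxE (le_trans (ler_normD _ _)) // lerD ?coord_le_norm // mxE normrN.
  exact: HM.
exists (y *m invmx (AR - 1)); set x := y *m _.
have : x *m (AR - 1) = y by rewrite /x mulmxKV.
rewrite -yE -/x mulmxBr mulmx1 /p => /eqP; rewrite opprB.
by rewrite addrCA => /eqP /addrI E; rewrite -[F x](subrK (lattice_row v)) -opprB
  -E opprK.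
Qed.

End TorusLift.

(** * Displacement on the first homology group *)

Section TorusHomology.
Local Open Scope classical_set_scope.
Local Open Scope ring_scope.
Context {R : realType}.
Local Notation V := 'rV[R]_2.
Local Notation T2 := (torus R).

(** * Parametrizing the standard simplices by the line and the plane *)

Definition simplex_pt (T : Type) n (F : T -> 'rV[R]_n.+1)
    (FP : forall t, std_simplex R n (F t)) (t : T) : std_simplex R n :=
  exist _ (F t) (mem_set (FP t)).

Lemma simplex_pt_continuous (T : topologicalType) n (F : T -> 'rV[R]_n.+1)
    (FP : forall t, std_simplex R n (F t)) :
  continuous F -> continuous (simplex_pt T n F FP).
Proof.
by move=> /continuousP cF; apply/continuousP => _ [A oA <-]; exact: cF.
Qed.

Definition edge_row (t : R) : V := row2 (1 - clamp t) (clamp t).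

Lemma edge_row_simplex t : std_simplex R 1 (edge_row t).
Proof.
have /andP[h0 h1] := clamp_itv t; split.
  by apply: ord2P; rewrite ?row2_0 ?row2_1 // subr_ge0.
by rewrite big_ord_recl big_ord1 !mxE /= subrK.
Qed.

Definition edge : R -> std_simplex R 1 := simplex_pt R 1 edge_row edge_row_simplex.

Lemma edgeE t : set_val (edge t) = edge_row t. Proof. by []. Qed.

Lemma edge_continuous : continuous edge.
Proof.
apply: simplex_pt_continuous => t.
apply: (continuous_row2 R (fun t => 1 - clamp t) clamp); last exact: clamp_continuous.
exact: cvgB (cvg_cst _) (clamp_continuous t).
Qed.

(* The square, collapsed onto the triangle along the side of abscissa 0. *)
Definition triangle_row (x : V) : 'rV[R]_3 :=
  let a := clamp (x 0 0) in let b := clamp (x 0 1) in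
  \row_j (if j == 0 then 1 - a else if j == 1 then a * (1 - b) else a * b).

Lemma triangle_row_simplex x : std_simplex R 2 (triangle_row x).
Proof.
have /andP[a0 a1] := clamp_itv (x 0 0); have /andP[b0 b1] := clamp_itv (x 0 1).
split=> [j|].
  by rewrite mxE; do 2?case: ifP => _; rewrite ?mulr_ge0 // subr_ge0.
rewrite 2!big_ord_recl big_ord1 !mxE /=; ring.
Qed.

Definition triangle : V -> std_simplex R 2 :=
  simplex_pt V 2 triangle_row triangle_row_simplex.

Lemma triangle_continuous : continuous triangle.
Proof.
apply: simplex_pt_continuous => x.
have c j : {for x, continuous (fun x : V => clamp (x 0 j))}.
  apply: (@continuous_comp V R R (fun x : V => x 0 j) clamp).
    exact: coord_continuous.
  exact: clamp_continuous.
have c1 j : {for x, continuous (fun x : V => 1 - clamp (x 0 j))}.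
  exact: cvgB (cvg_cst _) (c j).
apply: continuous_row => j.
under [X in {for x, continuous X}]funext => y do rewrite mxE.
case: (j == 0); first exact: c1.
by case: (j == 1); [exact: cvgM (c 0) (c1 1)|exact: cvgM (c 0) (c 1)].
Qed.

Lemma face0_edge t : 0 <= t <= 1 -> face 0 (edge t) = triangle (row2 1 t).
Proof.
move=> t01; apply: val_inj; apply/rowP => j /=.
rewrite [RHS]mxE row2_0 row2_1 !clamp_id ?lexx ?ler01 //.
case: (unliftP 0 j) => [k ->|->]; last by rewrite face_row_id subrr.
rewrite face_row_lift edgeE /edge_row clamp_id //; move: k; apply: ord2P.
  by rewrite row2_0 /= mul1r.
by rewrite row2_1 /= mul1r.
Qed.

Lemma face1_edge t : 0 <= t <= 1 -> face 1 (edge t) = triangle (row2 t 1).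
Proof.
move=> t01; apply: val_inj; apply/rowP => j /=.
rewrite [RHS]mxE row2_0 row2_1 !clamp_id ?lexx ?ler01 //.
case: (unliftP 1 j) => [k ->|->]; last by rewrite face_row_id subrr mulr0.
rewrite face_row_lift edgeE /edge_row clamp_id //; move: k; apply: ord2P.
  by rewrite row2_0.
by rewrite row2_1 /= mulr1.
Qed.

Lemma face2_edge t : 0 <= t <= 1 -> face ord_max (edge t) = triangle (row2 t 0).
Proof.
move=> t01; apply: val_inj; apply/rowP => j /=.
rewrite [RHS]mxE row2_0 row2_1 !clamp_id ?lexx ?ler01 //.
case: (unliftP ord_max j) => [k ->|->]; last by rewrite face_row_id /= mulr0.
rewrite face_row_lift edgeE /edge_row clamp_id //; move: k; apply: ord2P.
  by rewrite row2_0.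
by rewrite row2_1 /= subr0 mulr1.
Qed.

Lemma path_continuous (s : simplex R 1 T2) : continuous (s \o edge).
Proof.
move=> t; apply: continuous_comp; [exact: edge_continuous|exact: cts_fun].
Qed.

(** The increment of a chosen lift; [displacementE] shows that any lift gives the same vector. *)
Definition displacement (s : simplex R 1 T2) : V :=
  let G := s2val (cid2 (path_lift _ (path_continuous s))) in G 1 - G 0.

Lemma displacementE (s : simplex R 1 T2) (G : R -> V) : continuous G ->
  (forall t, 0 <= t <= 1 -> torus_pi (G t) = s (edge t)) ->
    displacement s = G 1 - G 0.
Proof.
move=> cG GP; rewrite /displacement; case: cid2 => /= H cH HP.
by apply: lift_increment => // t t01; rewrite HP GP.
Qed.

(** Lift the triangle over the square: three sides project to the faces and the fourth is collapsed
    to a vertex, while the increments around the square cancel. *)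
Lemma displacement_triangle (s : simplex R 2 T2) :
  displacement (face_of 0 s) - displacement (face_of 1 s) + displacement
    (face_of ord_max s) = 0.
Proof.
have [|G cG GP] := torus_lift 2 (s \o triangle).
  by move=> x; apply: continuous_comp; [exact: triangle_continuous|exact: cts_fun].
have cG2 (f g : R -> R) : continuous f -> continuous g ->
    continuous (fun t => G (row2 (f t) (g t))).
  move=> cf cg t; apply: (@continuous_comp R V V (fun t => row2 (f t) (g t)) G).
    exact: (continuous_row2 R f g t (cf t) (cg t)).
  exact: cG.
have cc (a : R) : continuous (fun _ : R => a) by move=> ?; exact: cvg_cst.
have ci : continuous (fun t : R => t) by move=> ?; exact: cvg_id.
rewrite (displacementE _ _ (cG2 _ _ (cc 1) ci)); last by move=> t t01;
  rewrite GP /= face0_edge.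
rewrite (displacementE _ _ (cG2 _ _ ci (cc 1))); last by move=> t t01;
  rewrite GP /= face1_edge.
rewrite (displacementE _ _ (cG2 _ _ ci (cc 0))); last by move=> t t01;
  rewrite GP /= face2_edge.
have : G (row2 0 1) - G (row2 0 0) = G (row2 0 0) - G (row2 0 0).
  apply: (lift_increment (fun t => G (row2 0 t)) (fun=> G (row2 0 0))).
  - exact: cG2.
  - by move=> ?; exact: cvg_cst.
  - move=> t t01; rewrite !GP /=; congr (s _); apply: val_inj; apply/rowP => j.
    change (triangle_row (row2 0 t) 0 j = triangle_row (row2 0 0) 0 j).
    by rewrite /triangle_row ![X in X = _]mxE ![X in _ = X]mxE !row2_0 clamp_id
      ?lexx ?ler01 // !mul0r.
rewrite subrr => /eqP; rewrite subr_eq0 => /eqP ->.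
by apply/rowP => j; rewrite !mxE; ring.
Qed.

(** * Extending functions of simplices to chains *)

Definition chain_sum n (phi : simplex R n T2 -> V) (c : chain R n T2) : V :=
  fglift (phi : simplex R n T2 -> zmodule V) c.

Fact chain_sum_zmod_morphism n phi : zmod_morphism (chain_sum n phi).
Proof.
by move=> c d; exact: (lift_is_additive (phi : simplex R n T2 -> zmodule V) c d).
Qed.

HB.instance Definition _ n phi := GRing.isZmodMorphism.Build _ _
  (chain_sum n phi) (chain_sum_zmod_morphism n phi).

Lemma chain_sumU n phi k (s : simplex R n T2) :
  chain_sum n phi << k *g s >> = phi s *~ k.
Proof. exact: (liftU (phi : simplex R n T2 -> zmodule V) k s). Qed.

Lemma chain_sum_boundary (c : chain R 2 T2) : chain_sum 1 displacement
  (boundary c) = 0.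
Proof.
rewrite -(freeg_sumE c) !raddf_sum big1 //= => s _.
rewrite boundaryU raddf_sum 2!big_ord_recl big_ord1 /= !chain_sumU.
set k := coeff s c.
have -> : lift ord0 ord0 = 1 :> 'I_3 by apply: val_inj.
have -> : lift ord0 (lift ord0 ord0) = ord_max :> 'I_3 by apply: val_inj.
have := displacement_triangle s => /(congr1 (fun v => v *~ k)).
rewrite mul0rz mulrzDl mulrzBl => <-.
rewrite !expr0 /= /bump /= expr1 sqrrN expr1n !mulr1 mulrN1 mulrNz.
by rewrite addrA.
Qed.

Fact vertex_row_simplex : std_simplex R 0 (\row_j 1).
Proof. by split=> [i|]; rewrite ?mxE ?ler01 // big_ord1 mxE. Qed.

Definition vertex : std_simplex R 0 :=
  simplex_pt unit 0 (fun=> \row_j 1) (fun=> vertex_row_simplex) tt.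

Lemma vertexP (x : std_simplex R 0) : x = vertex.
Proof.
apply: val_inj; apply/rowP => j; rewrite ord1 mxE.
by have [_] := set_mem (valP x); rewrite big_ord1.
Qed.

Lemma face0_vertex : face 0 vertex = edge 1.
Proof.
apply: val_inj; apply/rowP => j.
change (face_row 0 (set_val vertex) 0 j = edge_row 1 0 j);
  rewrite /edge_row clamp_id ?lexx ?ler01 //.
case: (unliftP 0 j) => [k ->|->]; last by rewrite face_row_id row2_0 subrr.
by rewrite face_row_lift mxE (_ : lift 0 k = 1) ?row2_1 //; rewrite ord1;
  exact: val_inj.
Qed.

Lemma face1_vertex : face 1 vertex = edge 0.
Proof.
apply: val_inj; apply/rowP => j.
change (face_row 1 (set_val vertex) 0 j = edge_row 0 0 j);
  rewrite /edge_row clamp_id ?lexx ?ler01 //.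
case: (unliftP 1 j) => [k ->|->]; last by rewrite face_row_id row2_1.
by rewrite face_row_lift mxE (_ : lift 1 k = 0) ?row2_0 ?subr0 //; rewrite ord1;
  exact: val_inj.
Qed.

(** The coboundary of a function of points vanishes on cycles; displacements can therefore be
    corrected by differences of a potential. *)
Lemma chain_sum_boundary1 (pot : V -> V) (c : chain R 1 T2) :
  chain_sum 0 (fun p => pot (repr (p vertex))) (boundary c) =
  chain_sum 1 (fun s => pot (repr (s (edge 1))) - pot (repr (s (edge 0)))) c.
Proof.
rewrite -(freeg_sumE c) !raddf_sum; apply: eq_bigr => s _ /=.
rewrite boundaryU raddf_sum big_ord_recl big_ord1 /= !chain_sumU.
have -> : lift ord0 ord0 = 1 :> 'I_2 by apply: val_inj.
rewrite /face_of /= face0_vertex face1_vertex expr0 expr1 mulr1 mulrN1 mulrNz.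
by rewrite mulrzBl.
Qed.

Lemma chain_sum_eq n (phi psi : simplex R n T2 -> V) c :
  (forall s, phi s = psi s) -> chain_sum n phi c = chain_sum n psi c.
Proof. by move=> E; rewrite (_ : phi = psi) //; apply/funext. Qed.

Lemma chain_sumD n (phi psi : simplex R n T2 -> V) c :
  chain_sum n (fun s => phi s + psi s) c = chain_sum n phi c + chain_sum n psi c.
Proof.
rewrite -(freeg_sumE c) !raddf_sum -big_split; apply: eq_bigr => s _ /=.
by rewrite !chain_sumU mulrzDl.
Qed.

Lemma chain_sum_mulmx n (phi : simplex R n T2 -> V) (N : 'M[R]_2) c :
  chain_sum n (fun s => phi s *m N) c = chain_sum n phi c *m N.
Proof.
rewrite -(freeg_sumE c) !raddf_sum mulmx_suml; apply: eq_bigr => s _ /=.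
by rewrite !chain_sumU -(scaler_int _ (_ *m _)) scalemxAl scaler_int.
Qed.

Lemma chain_sum_push n (f : continuousType T2 T2) phi c :
  chain_sum n phi (push_chain f c) =
  chain_sum n (fun s => phi (push_simplex f s)) c.
Proof.
rewrite -(freeg_sumE c) !raddf_sum; apply: eq_bigr => s _ /=.
by rewrite push_chainU !chain_sumU.
Qed.

Lemma chain_sum_integral n (phi : simplex R n T2 -> V) c :
  (forall s, exists w, phi s = lattice_row w) -> exists w, chain_sum n phi c =
    lattice_row w.
Proof.
move=> H; have [w wP] := choice H.
rewrite -(freeg_sumE c) raddf_sum.
elim/big_rec: _ => [|s x _ [v ->]]; first by exists 0; rewrite lattice_row0.
exists (w s *~ coeff s c + v); by rewrite /= chain_sumU wP lattice_rowD raddfMz.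
Qed.

Lemma displacement_lift (s : simplex R 1 T2) : exists2 G : R -> V,
  displacement s = G 1 - G 0 & continuous G /\
    forall t, torus_pi (G t) = s (edge t).
Proof.
have [G cG GP] := path_lift _ (path_continuous s).
by exists G => //; apply: displacementE => // t _; exact: GP.
Qed.

(** Each displacement equals, up to a lattice vector, the difference [ends] of the representatives
    of its end points, and these differences sum to 0 on a cycle. *)
Lemma displacement_cycle (z : cycle (R := R) 1 T2) : exists w, chain_sum 1
  displacement z = lattice_row w.
Proof.
case: z => c /= /eqP bc.
pose ends (s : simplex R 1 T2) : V := repr (s (edge 1)) - repr (s (edge 0)).
have [s|w E] := chain_sum_integral 1 (fun s => displacement s + - ends s) c.
  have [G -> [_ GP]] := displacement_lift s.
  have /torus_pi_eq[w1 ->] : torus_pi (G 1) = torus_pi (repr (s (edge 1)))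
    by rewrite GP torus_pi_repr.
  have /torus_pi_eq[w0 ->] : torus_pi (G 0) = torus_pi (repr (s (edge 0)))
    by rewrite GP torus_pi_repr.
  by exists (w1 - w0); rewrite lattice_rowB /ends; apply/rowP => j; rewrite !mxE;
    ring.
exists w; rewrite -E chain_sumD.
have E0 := chain_sum_boundary1 (fun v => - v) c; rewrite bc raddf0 in E0.
rewrite -[LHS]addr0 E0; congr (_ + _); apply: chain_sum_eq => s.
by rewrite /ends opprD.
Qed.

(** Pushing replaces G 1 - G 0 by F (G 1) - F (G 0). The discrepancy from (G 1 - G 0) A is a
    difference of values of [pot], which is periodic and so depends only on the points of the torus;
    it sums to 0 on a cycle. *)
Lemma displacement_push (f : continuousType T2 T2) F A (z : cycle (R := R) 1 T2) :
  continuous F -> (forall x, torus_pi (F x) = f (torus_pi x)) -> equivariant F A ->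
  chain_sum 1 displacement (push_cycle f z) = chain_sum 1 displacement z *m
    map_mx intr A.
Proof.
move=> cF FP eF; case: z => c /= /eqP bc.
rewrite chain_sum_push -chain_sum_mulmx.
pose pot (x : V) := F x - x *m map_mx intr A.
have := chain_sum_boundary1 pot c; rewrite bc raddf0 => E0.
rewrite -[RHS]addr0 E0 -chain_sumD; apply: chain_sum_eq => s.
have [G -> [cG GP]] := displacement_lift s.
have -> : displacement (push_simplex f s) = F (G 1) - F (G 0).
  apply: (displacementE _ (F \o G)).
    by move=> t; apply: continuous_comp; [exact: cG|exact: cF].
  by move=> t _; rewrite /= FP GP.
have potE t : pot (repr (s (edge t))) = pot (G t).
  have /torus_pi_eq[w ->] : torus_pi (G t) = torus_pi (repr (s (edge t)))
    by rewrite GP torus_pi_repr.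
  by rewrite /pot eF lattice_rowM mulmxDl opprD addrACA subrr addr0.
by rewrite !potE /pot mulmxBl; apply/rowP => j; rewrite !mxE; ring.
Qed.

Definition homology_displacement (a : homology R 1 T2) : V :=
  chain_sum 1 displacement (repr (a : Quotient.quot (@boundaries R 1 T2)) :
    cycle 1 T2).

Lemma homology_displacement_class (z : cycle (R := R) 1 T2) :
  homology_displacement (homology_class z) = chain_sum 1 displacement z.
Proof.
rewrite /homology_displacement; set w := repr _.
have /homology_classE/asboolP[c cE] : homology_class w = homology_class z.
  exact: reprK.
apply/eqP; rewrite -subr_eq0 -raddfB.
have := chain_sum_boundary c; rewrite cE /= => E.
by apply/eqP; rewrite -E; congr chain_sum.
Qed.

Lemma homology_class_repr (a : homology R 1 T2) :
  homology_class (repr (a : Quotient.quot (@boundaries R 1 T2))) = a.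
Proof. exact: reprK. Qed.

Fact homology_displacement_zmod_morphism : zmod_morphism homology_displacement.
Proof.
move=> a b; rewrite -(homology_class_repr a) -(homology_class_repr b).
have cB : zmod_morphism (@homology_class R 1 T2).
  by move=> x y; rewrite /homology_class; exact: raddfB.
by rewrite -cB !homology_displacement_class -raddfB.
Qed.
HB.instance Definition _ := GRing.isZmodMorphism.Build _ _ homology_displacement
  homology_displacement_zmod_morphism.

Lemma homology_displacement_integral a : exists w, homology_displacement a =
  lattice_row w.
Proof. exact: displacement_cycle. Qed.

Lemma homology_displacement_map (f : continuousType T2 T2) F A a :
  continuous F -> (forall x, torus_pi (F x) = f (torus_pi x)) -> equivariant F A ->
  homology_displacement (homology_map f a) = homology_displacement a *m map_mx intr A.
Proof.
move=> cF FP eF; rewrite -{1}(homology_class_repr a) homology_map_class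
  homology_displacement_class.
exact: displacement_push.
Qed.

(** The segment from 0 to [w], closed up in the torus; the second barycentric coordinate is the
    time. It realizes the displacement [w]. *)
Definition loop (w : 'rV[int]_2) (x : std_simplex R 1) : T2 :=
  torus_pi ((set_val x : V) 0 1 *: lattice_row w).

Lemma loop_continuous w : continuous (loop w).
Proof.
move=> x; apply: (@continuous_comp _ _ _ (fun x : std_simplex R 1 =>
  (set_val x : V) 0 1 *: lattice_row w) torus_pi); last exact: torus_pi_continuous.
apply: (@continuous_comp _ _ _ (fun x : std_simplex R 1 => (set_val x : V) 0 1)
  (fun t => t *: lattice_row w)); last exact: scalel_continuous.
apply: (@continuous_comp _ _ _ (fun x : std_simplex R 1 => (set_val x : V))
  (fun x : V => x 0 1)); last exact: coord_continuous.
exact: initial_continuous.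
Qed.

HB.instance Definition _ w := isContinuous.Build _ _ (loop w) (loop_continuous w).

Lemma loop_edge w t : 0 <= t <= 1 -> loop w (edge t) = torus_pi (t *: lattice_row w).
Proof. by move=> t01; rewrite /loop edgeE /edge_row row2_1 clamp_id. Qed.

Lemma loop_cycle w : cycles (<< (loop w : simplex R 1 T2) >> : chain R 1 T2).
Proof.
apply/eqP; rewrite boundaryU big_ord_recl big_ord1 /=.
have -> : lift ord0 ord0 = 1 :> 'I_2 by apply: val_inj.
have -> : face_of 1 (loop w) = face_of 0 (loop w).
  apply/continuousEP => x; rewrite (vertexP x) /face_of /= face0_vertex face1_vertex.
  change (loop w (edge 0) = loop w (edge 1)); rewrite !loop_edge ?lexx ?ler01 //
    scale0r scale1r -[lattice_row w]add0r torus_pi_lattice //.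
rewrite expr0 expr1 mulr1 mulrN1; apply/eqP/freeg_eqP => y.
by rewrite coeffD !coeffU coeff0 mulN1r mul1r subrr.
Qed.

Lemma homology_displacement_surj w : exists a, homology_displacement a =
  lattice_row w.
Proof.
exists (homology_class (Cycle (loop_cycle w)));
  rewrite homology_displacement_class /= chain_sumU mulr1z.
rewrite (displacementE _ (fun t => t *: lattice_row w)).
- by rewrite scale1r scale0r subr0.
- exact: scalel_continuous.
- by move=> t t01; exact: esym (loop_edge w t t01).
Qed.

End TorusHomology.

(** * Periodic points *)

Section Periods.
Local Open Scope classical_set_scope.
Local Open Scope ring_scope.
Context {R : realType}.
Local Notation V := 'rV[R]_2.
Local Notation T2 := (torus R).

(** Lift the homotopy along the loop of [w] over the square. Its bottom and top sides have
    increments [w *m A] and [w *m B]; its vertical sides lift the same path, so the two increments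
    agree. *)
Lemma homotopic_lift (f h : T2 -> T2) (F G : V -> V) A B : homotopic R f h ->
  continuous F -> (forall x, torus_pi (F x) = f (torus_pi x)) -> equivariant F A ->
  continuous G -> (forall x, torus_pi (G x) = h (torus_pi x)) ->
    equivariant G B -> A = B.
Proof.
move=> [H [cH H0 H1]] cF FP eF cG GP eG.
suff E (w : 'rV[int]_2) : w *m A = w *m B.
  by apply/row_matrixP => i; rewrite !rowE.
pose m (x : V) : T2 * R := (torus_pi (x 0 0 *: lattice_row w), clamp (x 0 1)).
have cm : continuous m.
  move=> x.
  have c0 : {for x, continuous (fun x : V => torus_pi (x 0 0 *: lattice_row w))}.
    apply: (@continuous_comp V V T2 (fun x : V => x 0 0 *: lattice_row w)
      torus_pi); last exact: torus_pi_continuous.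
    apply: (@continuous_comp V R V (fun x : V => x 0 0) (fun t => t *:
      lattice_row w)).
      exact: coord_continuous.
    exact: scalel_continuous.
  have c1 : {for x, continuous (fun x : V => clamp (x 0 1))}.
    apply: (@continuous_comp V R R (fun x : V => x 0 1) clamp).
      exact: coord_continuous.
    exact: clamp_continuous.
  exact: (cvg_pair c0 c1).
have [|L cL LP] := torus_lift 2 (H \o m).
  (* [H] is continuous only within times in [0, 1]; thanks to [clamp] the map [m] never leaves
     them. *)
  move=> x U /= nU.
  have mx : (setT `*` `[0, 1]%classic) (m x).
    by split=> //=; rewrite in_itv /= clamp_itv.
  have near_m : nbhs (m x) [set y | (setT `*` `[0, 1]%classic) y -> U (H y)].
    exact: ((subspace_continuousP _ _).1 cH (m x) mx U nU).
  have near_x : nbhs x (m @^-1` _) := cm x _ near_m.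
  apply: filterS near_x => y /=; apply; split=> //=.
  by rewrite in_itv /= clamp_itv.
have cL2 (p q : R -> R) : continuous p -> continuous q ->
    continuous (fun t => L (row2 (p t) (q t))).
  move=> cp cq t; apply: (@continuous_comp R V V (fun t => row2 (p t) (q t)) L).
    exact: (continuous_row2 R p q t (cp t) (cq t)).
  exact: cL.
have cc (a : R) : continuous (fun _ : R => a) by move=> ?; exact: cvg_cst.
have ci : continuous (fun t : R => t) by move=> ?; exact: cvg_id.
have mE s t : 0 <= t <= 1 -> m (row2 s t) = (torus_pi (s *: lattice_row w), t).
  by move=> t01; rewrite /m row2_0 row2_1 clamp_id.
have side (K : V -> V) : continuous K ->
  continuous (fun t : R => K (t *: lattice_row w)).
  by move=> cK t; apply: (@continuous_comp R V V (fun t : R => t *: lattice_row w) K);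
    [exact: scalel_continuous|exact: cK].
have EA : L (row2 1 0) - L (row2 0 0) = lattice_row (w *m A).
  rewrite (lift_increment (fun t => L (row2 t 0)) (fun t => F (t *: lattice_row w))).
  - by rewrite scale1r scale0r -[X in F X - _]add0r eF addrC addKr.
  - exact: cL2.
  - exact: side.
  - by move=> t t01; rewrite LP /= mE ?lexx ?ler01 // H0 FP.
have EB : L (row2 1 1) - L (row2 0 1) = lattice_row (w *m B).
  rewrite (lift_increment (fun t => L (row2 t 1)) (fun t => G (t *: lattice_row w))).
  - by rewrite scale1r scale0r -[X in G X - _]add0r eG addrC addKr.
  - exact: cL2.
  - exact: side.
  - by move=> t t01; rewrite LP /= mE ?lexx ?ler01 // H1 GP.
have EC : L (row2 1 1) - L (row2 1 0) = L (row2 0 1) - L (row2 0 0).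
  apply: (lift_increment (fun t => L (row2 1 t)) (fun t => L (row2 0 t))).
  - exact: cL2.
  - exact: cL2.
  - move=> t t01; rewrite !LP /= !mE // scale1r scale0r.
    by rewrite -[lattice_row w]add0r torus_pi_lattice.
apply: (@lattice_row_inj R); rewrite -EA -EB; apply/eqP.
rewrite -subr_eq0; apply/eqP; move: EC => /eqP; rewrite -subr_eq0 => /eqP E.
by apply: oppr_inj; rewrite oppr0 -E; apply/rowP => j; rewrite !mxE; ring.
Qed.

(** The rows of [P] are the displacements of the basis. Intertwining gives [P *m A = M^T *m P], the
    transpose passing from columns to rows, and surjectivity of the displacement gives an inverse
    [Q] of [P]. *)
Lemma homology_matrix_conj (f : continuousType T2 T2)
    (e : 'I_2 -> homology R 1 T2) M F A :
  is_Zbasis e -> is_matrix_of e (homology_map f) M ->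
  continuous F -> (forall x, torus_pi (F x) = f (torus_pi x)) -> equivariant F A ->
  \tr A = \tr M /\ \det A = \det M.
Proof.
move=> he hM cF FP eF.
have [p pP] := choice (fun i => homology_displacement_integral (e i)).
have hsum (c : 'I_2 -> int) :
    homology_displacement (\sum_i e i *~ c i) = lattice_row (\sum_i c i *: p i).
  rewrite raddf_sum [RHS]raddf_sum; apply: eq_bigr => i _.
  by rewrite raddfMz /= pP -[c i in RHS]intz scaler_int raddfMz.
pose P := \matrix_i p i.
have rowsE (c : 'I_2 -> int) : \sum_i c i *: p i = (\row_i c i) *m P.
  by rewrite mulmx_sum_row; apply: eq_bigr => i _; rewrite rowK mxE.
have span i : exists c : 'rV[int]_2, c *m P = delta_mx 0 i.
  have [a aE] := @homology_displacement_surj R (delta_mx 0 i).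
  have [c [cE _]] := he a.
  by exists (\row_i c i); apply: (@lattice_row_inj R); rewrite -rowsE -hsum -cE.
have [q qP] := choice span.
pose Q := \matrix_i q i.
have QP : Q *m P = 1%:M.
  by apply/row_matrixP => i; rewrite row_mul rowK qP rowE mulmx1.
have PA : P *m A = M^T *m P.
  apply/row_matrixP => j; rewrite !row_mul rowK; apply: (@lattice_row_inj R).
  have -> : row j M^T = \row_i M i j by apply/rowP => i; rewrite !mxE.
  rewrite lattice_rowM -pP -(homology_displacement_map f F) // hM hsum rowsE //.
have AE : A = Q *m M^T *m P by rewrite -mulmxA -PA mulmxA QP mul1mx.
split.
  by rewrite AE mxtrace_mulC mulmxA (mulmx1C QP) mul1mx mxtrace_tr.
rewrite AE !det_mulmx det_tr mulrAC -det_mulmx QP det1 mul1r //.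
Qed.

Section Iterates.
Context (h : T2 -> T2) (G : V -> V) (A : 'M[int]_2).
Context (cG : continuous G) (GP : forall x, torus_pi (G x) = h (torus_pi x))
  (eG : equivariant G A).

Lemma iter_lift k x : torus_pi (iter k G x) = iter k h (torus_pi x).
Proof. by elim: k => //= k <-; rewrite GP. Qed.

Lemma iter_continuous k : continuous (iter k G).
Proof.
elim: k => [|k IH] x; first exact: cvg_id.
by apply: continuous_comp; [exact: IH|exact: cG].
Qed.

Lemma iter_equivariant k : equivariant (iter k G) (A ^+ k).
Proof.
elim: k => [|k IH] x w; first by rewrite expr0 mulmx1.
by rewrite /= IH eG exprSr -mulmxE mulmxA.
Qed.

Lemma iter_fixed x u n : G x = x + lattice_row u ->
  iter n G x = x + lattice_row (u *m \sum_(i < n) A ^+ i).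
Proof.
move=> E; elim: n => [|n IH]; first by rewrite big_ord0 mulmx0 lattice_row0 addr0.
rewrite /= IH eG E big_ord_recl expr0 mulmxDr mulmx1 lattice_rowD addrA.
congr (_ + lattice_row _); rewrite -mulmxA; congr (_ *m _).
by rewrite mulmxE mulr_suml; apply: eq_bigr => i _; rewrite exprSr.
Qed.

(** Bezout: some multiple of [i] is one more than a multiple of [k]. *)
Lemma coprime_iter_fixed (p : T2) i k : (0 < i)%N -> coprime i k ->
  iter i h p = p -> iter k h p = p -> h p = p.
Proof.
move=> i0 cik hi hk.
have mult n a : iter n h p = p -> iter (a * n) h p = p.
  by move=> E; elim: a => // a IH; rewrite mulSn iterD IH.
case: (egcdnP k i0) => a b E _.
have := mult i a hi; rewrite E (eqP cik) addn1 iterS (mult k b hk).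
by [].
Qed.

(* For a prime [k], a fixed point of [iter k h] has period [1] or [k]; if
   [iter k G x = x + v], period [1] forces [v] into the image of
   [\sum_(i < k) A ^+ i]. *)
Lemma prime_period k : prime k -> `|\det (A - 1)| < `|\det (A ^+ k - 1)| ->
  periods h k.
Proof.
move=> pk lt_det; pose B : 'M[int]_2 := \sum_(i < k) A ^+ i.
have BE : A ^+ k - 1 = (A - 1) *m B by rewrite mulmxE -subrX1.
(* If [|\det B|] were at most 1, the factorization [BE] would contradict [lt_det]. *)
have [v vP] : exists v : 'rV[int]_2, forall u, v <> u *m B.
  apply: int_det_gt1_not_surj; rewrite ltNge; apply/negP => B1.
  by move: lt_det; rewrite BE det_mulmx normrM ltNge ler_piMr.
have [|x xE] := translate_solution _ _ v (iter_continuous k) (iter_equivariant k).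
  by rewrite -normr_gt0; exact: le_lt_trans lt_det.
split; first exact: prime_gt0.
exists (torus_pi x); split; first by rewrite -iter_lift xE torus_pi_lattice.
move=> i /andP[i0 ik] hi.
have k0 := prime_gt0 pk.
have cik : coprime i k.
  rewrite coprime_sym prime_coprime // gtnNdvd //.
  by rewrite -(prednK k0) ltnS.
have : torus_pi (G x) = torus_pi x.
  rewrite GP; apply: (coprime_iter_fixed _ i k) => //.
  by rewrite -iter_lift xE torus_pi_lattice.
move=> /torus_pi_eq[u uE]; apply: (vP u); apply: (@lattice_row_inj R).
by apply: (addrI x); rewrite -xE (iter_fixed x u).
Qed.

End Iterates.

Lemma infinite_nat_set (S : set nat) :
  (forall N, exists2 k, (N < k)%N & S k) -> infinite_set S.
Proof.
move=> unb /finite_fsetP[X SX].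
have [k] := unb (\max_(i <- finmap.enum_fset X) i).
rewrite SX /= ltnNge => /negP nk kX; apply: nk.
exact: leq_bigmax_seq.
Qed.

End Periods.

Import GRing.Theory Num.Theory.
Local Open Scope ring_scope.

Theorem corollary2 (R : realType) (f : continuousType (torus R) (torus R))
    (e : 'I_2 -> homology R 1 (torus R)) (he : is_Zbasis e)
    (M2 : 'M[int]_2) (hM2 : is_matrix_of e (homology_map f) M2)
    (t d : int) (ht : t = \tr M2) (hd : d = \det M2)
    (hL : - t + d + 1 != 0)
    (htd : (t, d) \notin [:: (0, 0); (-1, 0); (-2, 1); (0, 1); (-1, 1); (1, 1)]) :
  infinite_set (minimal_periods R f).
Proof.
have [F [A [cF FP eF]]] := torus_map_lift f (@cts_fun _ _ f).
have [trA detA] := homology_matrix_conj f e M2 F A he hM2 cF FP eF.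
rewrite ht hd -trA -detA in hL htd.
have [K KP] := det_expr_sub1_growth A `|\det (A - 1)| hL htd.
apply: infinite_nat_set => N.
(* [K] depends only on [A], hence on the homotopy class, so one prime serves every [h]. Exceeding 2
   makes it odd, exceeding [N] makes the set of periods unbounded. *)
have [k] := prime_above (maxn 2 (maxn K N)).
rewrite !gtn_max => /and3P[k2 Kk Nk] pk; exists k => // h /= fh.
have [G [B [cG GP eG]]] := torus_map_lift h (@cts_fun _ _ h).
have AB := homotopic_lift f h F G A B fh cF FP eF cG GP eG; subst B.
apply: (prime_period h G A cG GP eG) => //; apply: KP; first exact: ltnW.
by case: (even_prime pk) => // k2E; rewrite k2E in k2.
Qed.
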